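(* Let $E$ be a Banach lattice with a normalized basis $(e_i)$, satisfying a lower $2$-estimate with constant $M$. Then $(E\otimes_{|\pi|}E)/I_{\rm oc}$ is lattice isomorphic (lattice isometric if $M=1$) to $\ell_1$ via the map $(x_i)\in\ell_1\mapsto\sum_{i=1}^\infty x_i\,e_i\otimes e_i$.
   Context: All Banach lattices are real. A Banach lattice with a basis $(e_i)$ is a Banach lattice $E$ with a Schauder basis $(e_i)$ that defines the order: $x=\sum_{i=1}^\infty x_ie_i$ satisfies $x\ge0$ if and only if $x_i\ge0$ for all $i$. (Such a basis is automatically $1$-unconditional.) Normalized means $\|e_i\|=1$ for all $i$. A Banach lattice $E$ satisfies the lower $2$-estimate with constant $M>0$ if $\bigl\|\sum_{k=1}^n x_k\bigr\|\ge\frac1M\bigl(\sum_{k=1}^n\|x_k\|^2\bigr)^{1/2}$ whenever $x_1,\dots,x_n\in E$ are (pairwise) disjoint. $\ell_1$ has its usual norm and coordinatewise order. Fremlin tensor product: for Banach lattices $E,F$, the norm of $u$ in the algebraic tensor product $E\otimes F$ is $\|u\|_{|\pi|}=\sup\|\hat\varphi(u)\|$, where the supremum is over all Banach lattices $G$ and all positive bilinear maps $\varphi\colon E\times F\to G$ (i.e. $\varphi(x,y)\ge 0$ whenever $x,y\ge 0$) with $\|\varphi\|=\sup\{\|\varphi(x,y)\|:\|x\|\le1,\|y\|\le1\}\le 1$, and $\hat\varphi$ is the induced linear map on $E\otimes F$. The completion of $E\otimes F$ in this norm is a Banach lattice (its positive cone is the closure of the convex cone generated by $x\otimes y$ with $x,y\ge0$),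 denoted $E\otimes_{|\pi|}F$. It has the universal property that continuous positive bilinear maps $\varphi\colon E\times F\to G$ correspond one-to-one and norm-preservingly to positive operators $T\colon E\otimes_{|\pi|}F\to G$ with $T(x\otimes y)=\varphi(x,y)$; $T$ is a lattice homomorphism if and only if $|\varphi(x,y)|=\varphi(|x|,|y|)$ for all $x,y$. $I_{\rm oc}$ denotes the norm closed order ideal of $E\otimes_{|\pi|}E$ generated by $\{x\otimes y : x,y\in E,\ x\perp y\}$. When $E$ has a basis $(e_i)$, $(e_i\otimes e_j)_{i,j}$ is a disjoint $1$-unconditional basis of $E\otimes_{|\pi|}E$, $I_{\rm oc}$ is the closed span of $\{e_i\otimes e_j: i\ne j\}$, and the quotient $(E\otimes_{|\pi|}E)/I_{\rm oc}$ is identified with the complementary band, the closed span of $\{e_i\otimes e_i: i\in\mathbb N\}$ in $E\otimes_{|\pi|}E$ (each coset corresponding to its unique representative in this closed span). *)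

(* Defs.v *)
From HB Require Import structures.
From mathcomp Require Import all_boot all_order all_algebra sesquilinear.
From mathcomp Require Import generic_quotient ring_quotient.
From mathcomp Require Import all_classical all_reals topology normedtype sequences.
From mathcomp Require Import lra.

Set Implicit Arguments.
Unset Strict Implicit.
Unset Printing Implicit Defensive.

Import Order.TTheory GRing.Theory Num.Theory.
Import numFieldNormedType.Exports.

Local Open Scope classical_set_scope.
Local Open Scope ring_scope.

(* The order is a field of the mixin rather than an instance of Order.Lattice,
   which has no join with the normed module hierarchy. The axioms on ble and
   bjoin make E a vector lattice (infima are given by bmeet below); ble_norm
   says that `|.| is a lattice norm. *)
HB.mixin Record CompleteNormedModule_isBanachLattice (R : realType) E
    of CompleteNormedModule R E := {
  ble : E -> E -> Prop ;
  bjoin : E -> E -> E ;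
  ble_refl : forall x, ble x x ;
  ble_anti : forall x y, ble x y -> ble y x -> x = y ;
  ble_trans : forall y x z, ble x y -> ble y z -> ble x z ;
  bjoinP : forall x y z, ble (bjoin x y) z <-> ble x z /\ ble y z ;
  bleD2r : forall z x y, ble x y -> ble (x + z) (y + z) ;
  bleZ2l : forall (a : R) x y, 0 <= a -> ble x y -> ble (a *: x) (a *: y) ;
  ble_norm : forall x y, ble (bjoin x (- x)) (bjoin y (- y)) -> `|x| <= `|y|
}.

#[short(type="banachLatticeType")]
HB.structure Definition BanachLattice (R : realType) :=
  {E of CompleteNormedModule R E & CompleteNormedModule_isBanachLattice R E}.

Reserved Notation "x '<=L' y" (at level 70, no associativity).
Reserved Notation "x \vee y" (at level 50, left associativity).
Reserved Notation "x \wedge y" (at level 48, left associativity).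
Notation "x '<=L' y" := (ble x y) : ring_scope.
Notation "x \vee y" := (bjoin x y) : ring_scope.

Definition bmeet (R : realType) (E : banachLatticeType R) (x y : E) : E :=
  - (- x \vee - y).
Notation "x \wedge y" := (bmeet x y) : ring_scope.

Definition vabs (R : realType) (E : banachLatticeType R) (x : E) : E :=
  x \vee - x.

Definition disjoint_vec (R : realType) (E : banachLatticeType R) (x y : E) :=
  vabs x \wedge vabs y = 0.

Section VectorLatticeTheory.
Context {R : realType} {E : banachLatticeType R}.
Implicit Types x y z w : E.

Lemma ble_subr x y : x <=L y <-> 0 <=L y - x.
Proof.
split=> [/(bleD2r (- x))|/(bleD2r x)]; first by rewrite subrr.
by rewrite add0r subrK.
Qed.

Lemma bleN x y : x <=L y <-> - y <=L - x.
Proof. by rewrite (ble_subr x) (ble_subr (- y)) opprK addrC. Qed.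

Lemma bmeetP x y z : z <=L x \wedge y <-> z <=L x /\ z <=L y.
Proof.
rewrite /bmeet -{1}(opprK z) -bleN bjoinP.
by rewrite (bleN z x) (bleN z y).
Qed.

Lemma bleD x y z w : x <=L y -> z <=L w -> x + z <=L y + w.
Proof.
move=> xy zw; apply: (@ble_trans _ _ (y + z)); first exact: bleD2r.
by rewrite ![y + _]addrC; exact: bleD2r.
Qed.

Lemma bleD2E z x y : x + z <=L y + z <-> x <=L y.
Proof. by rewrite (ble_subr x) (ble_subr (x + z)) opprD addrACA subrr addr0. Qed.

Lemma bjoinL x y : x <=L x \vee y.
Proof. by have /bjoinP[] := @ble_refl _ E (x \vee y). Qed.

Lemma bjoinR x y : y <=L x \vee y.
Proof. by have /bjoinP[] := @ble_refl _ E (x \vee y). Qed.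

Lemma bmeetL x y : x \wedge y <=L x.
Proof. by have /bmeetP[] := @ble_refl _ E (x \wedge y). Qed.

Lemma bmeetR x y : x \wedge y <=L y.
Proof. by have /bmeetP[] := @ble_refl _ E (x \wedge y). Qed.

Lemma vabs_ler x : x <=L vabs x. Proof. exact: bjoinL. Qed.
Lemma vabs_lerN x : - x <=L vabs x. Proof. exact: bjoinR. Qed.

Lemma vabsP x y : vabs x <=L y <-> x <=L y /\ - x <=L y.
Proof. exact: bjoinP. Qed.

Lemma vabsN x : vabs (- x) = vabs x.
Proof.
apply: ble_anti; apply/vabsP; split; rewrite ?opprK.
- exact: vabs_lerN.
- exact: vabs_ler.
- by have := vabs_lerN (- x); rewrite opprK.
- exact: vabs_ler.
Qed.

Lemma vabs_ge0 x : 0 <=L vabs x.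
Proof.
have : x - x <=L vabs x + vabs x.
  by apply: bleD; [exact: vabs_ler|exact: vabs_lerN].
have h0 : (0 : R) <= 2^-1 by rewrite invr_ge0.
rewrite subrr => /(bleZ2l _ _ _ h0); rewrite scaler0 -mulr2n -[vabs x *+ 2]scaler_nat.
by rewrite scalerA mulVf ?pnatr_eq0// scale1r.
Qed.

Lemma ger0_vabs x : 0 <=L x -> vabs x = x.
Proof.
move=> x0; apply: ble_anti; last exact: vabs_ler.
apply/vabsP; split; first exact: ble_refl.
by apply: (@ble_trans _ _ 0) => //; rewrite -oppr0; apply/bleN; rewrite !opprK.
Qed.

Lemma ler_vabsD x y : vabs (x + y) <=L vabs x + vabs y.
Proof.
by apply/vabsP; rewrite opprD; split; apply: bleD;
  (exact: vabs_ler || exact: vabs_lerN).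
Qed.

Lemma vabs_idem x : vabs (vabs x) = vabs x.
Proof. by rewrite ger0_vabs//; exact: vabs_ge0. Qed.

Definition vpos x := x \vee 0.

Lemma vposP x y : vpos x <=L y <-> x <=L y /\ 0 <=L y.
Proof. exact: bjoinP. Qed.

Lemma vpos_ge0 x : 0 <=L vpos x. Proof. exact: bjoinR. Qed.
Lemma vpos_ge x : x <=L vpos x. Proof. exact: bjoinL. Qed.

Lemma vpos_le x y : x <=L y -> vpos x <=L vpos y.
Proof.
move=> xy; apply/vposP; split; last exact: vpos_ge0.
by apply: (ble_trans _ _ _ xy); exact: vpos_ge.
Qed.

Lemma vposD x y : vpos (x + y) <=L vpos x + vpos y.
Proof.
apply/vposP; split; first by apply: bleD; exact: vpos_ge.
by rewrite -[0]addr0; apply: bleD; exact: vpos_ge0.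
Qed.

Lemma bjoinD x y z : (x + z) \vee (y + z) = (x \vee y) + z.
Proof.
apply: ble_anti.
  by apply/bjoinP; split; apply/bleD2E; [exact: bjoinL|exact: bjoinR].
rewrite -(bleD2E (- z)) addrK; apply/bjoinP.
split; rewrite -(bleD2E z) subrK; [exact: bjoinL|exact: bjoinR].
Qed.

Lemma vposB x : vpos x - vpos (- x) = x.
Proof.
by apply/eqP; rewrite subr_eq /vpos addrC -bjoinD addNr add0r; apply/eqP;
  apply: ble_anti; apply/bjoinP; split; (exact: bjoinL || exact: bjoinR).
Qed.

Lemma vpos_vabs x : vpos x <=L vabs x.
Proof. by apply/vposP; split; [exact: vabs_ler|exact: vabs_ge0]. Qed.

Lemma bjoin_dist x y z w :
  vabs ((x \vee y) - (z \vee w)) <=L vabs (x - z) + vabs (y - w).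
Proof.
have aux (a b c d : E) : (a \vee b) - (c \vee d) <=L vabs (a - c) + vabs (b - d).
  rewrite -(bleD2E (c \vee d)) subrK addrC; apply/bjoinP; split.
    rewrite -{1}(subrK c a) (addrC _ c); apply: bleD; first exact: bjoinL.
    rewrite -[a - c]addr0; apply: bleD; last exact: vabs_ge0.
    by rewrite addr0; exact: vabs_ler.
  rewrite -{1}(subrK d b) (addrC _ d); apply: bleD; first exact: bjoinR.
  rewrite -[b - d]add0r; apply: bleD; first exact: vabs_ge0.
  by rewrite add0r; exact: vabs_ler.
apply/vabsP; split=> //; rewrite opprB -(vabsN (x - z)) -(vabsN (y - w)) !opprB.
exact: aux.
Qed.

End VectorLatticeTheory.

Section CompletenessCriterion.
Context (R : realType) (V : normedModType R).

Lemma half_exp_small (eps : R) : 0 < eps ->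
  exists n : nat, forall m, (n <= m)%N -> 2^-1 ^+ m < eps.
Proof.
move=> e0; have h : `|2^-1 : R| < 1 by rewrite ger0_norm ?invr_ge0// invf_lt1// ltr1n.
have /cvgrPdist_lt/(_ _ e0)[n _ nP] := cvg_expr h.
exists n => m nm; have := nP m nm.
by rewrite /= sub0r normrN ger0_norm// exprn_ge0// invr_ge0.
Qed.

Lemma cauchy_cvg_of_series :
  (forall u : nat -> V, (forall n, `|u n| <= 2^-1 ^+ n) -> cvgn (series u)) ->
  forall F : set_system V, ProperFilter F -> cauchy F -> cvg F.
Proof.
move=> H F FF /cauchyP Fc.
have e0 n : 0 < (2^-1 : R) ^+ n.+2 by rewrite exprn_gt0// invr_gt0.
have /choice[x xF] : forall n, exists y, F (ball y (2^-1 ^+ n.+2)).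
  by move=> n; exact: Fc.
have x1 n : `|x n.+1 - x n| <= 2^-1 ^+ n.
  have [y []] := filter_ex (filterI (xF n) (xF n.+1)).
  rewrite -!ball_normE /= => h1 h2.
  rewrite (_ : x n.+1 - x n = (x n.+1 - y) - (x n - y)); last first.
    by rewrite opprB addrA subrK.
  apply: (le_trans (ler_normB _ _)); move: h1 h2; rewrite !exprS.
  have : 0 < (2^-1 : R) ^+ n by rewrite exprn_gt0// invr_gt0.
  by lra.
have /cvg_ex[l xl] := H _ x1.
have {}xl : x @ \oo --> x 0%N + l.
  have xE : x = fun n => x 0%N + series (fun k => x k.+1 - x k) n.
    apply/funext => n; rewrite /series /= telescope_sumr//.
    by rewrite addrC subrK.
  by rewrite {1}xE; exact: (cvgD (cvg_cst _) xl).
apply/cvg_ex; exists (x 0%N + l); apply/cvg_ballP => eps eps0.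
have [N NP] := half_exp_small (divr_gt0 eps0 (ltr0n _ 2)).
have /cvgrPdist_lt/(_ _ (divr_gt0 eps0 (ltr0n _ 2)))[K _ KP] := xl.
pose m := maxn N K.
have hm := KP m (leq_maxr _ _); have hN := NP m.+2.
apply: filterS (xF m) => y; rewrite -!ball_normE /= => hy.
rewrite -(subrK (x m) (x 0%N + l)) -addrA (le_lt_trans (ler_normD _ _))//.
have := hN (leq_trans (leq_maxl N K) (leq_trans (leqnSn _) (leqnSn _))).
by move: hm hy => /=; lra.
Qed.

End CompletenessCriterion.

Record closedIdeal (R : realType) (E : banachLatticeType R) := ClosedIdeal {
  ideal_set :> E -> Prop ;
  ideal0 : ideal_set 0 ;
  idealD : forall x y, ideal_set x -> ideal_set y -> ideal_set (x + y) ;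
  idealZ : forall (a : R) x, ideal_set x -> ideal_set (a *: x) ;
  ideal_solid : forall x y, vabs x <=L vabs y -> ideal_set y -> ideal_set x ;
  ideal_closed : closed ideal_set
}.

Section GeneratedIdeal.
Context (R : realType) (E : banachLatticeType R) (A : set E).

Let gen := [set x | forall J : closedIdeal E, A `<=` ideal_set J -> J x].

Let gen0 : gen 0.
Proof. by move=> J _; exact: ideal0. Qed.

Let genD x y : gen x -> gen y -> gen (x + y).
Proof. by move=> gx gy J AJ; apply: idealD; [exact: gx|exact: gy]. Qed.

Let genZ (a : R) x : gen x -> gen (a *: x).
Proof. by move=> gx J AJ; apply: idealZ; exact: gx. Qed.

Let gen_solid x y : vabs x <=L vabs y -> gen y -> gen x.
Proof. by move=> xy gy J AJ; apply: (ideal_solid xy); exact: gy. Qed.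

Let gen_closed : closed gen.
Proof.
move=> x clx J AJ; apply: ideal_closed => B /clx[y [gy By]].
by exists y; split => //; exact: gy.
Qed.

Definition ideal_gen : closedIdeal E :=
  ClosedIdeal gen0 genD genZ gen_solid gen_closed.

End GeneratedIdeal.

Section IdealMem.
Context (R : realType) (E : banachLatticeType R) (J : closedIdeal E).

Definition ideal_mem : E -> bool := fun x => `[< J x >].

Let ideal_mem_zmod_closed : zmod_closed ideal_mem.
Proof.
split=> [|x y /asboolP Jx /asboolP Jy]; first exact/asboolP/ideal0.
by apply/asboolP; apply: idealD => //; rewrite -scaleN1r; exact: idealZ.
Qed.

HB.instance Definition _ :=
  GRing.isZmodClosed.Build E ideal_mem ideal_mem_zmod_closed.

Definition ideal_zmodClosed : zmodClosed E :=
  GRing.ZmodClosed.clone E ideal_mem _.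

End IdealMem.

Definition ideal_quotient (R : realType) (E : banachLatticeType R)
  (J : closedIdeal E) := @Quotient.quot E (ideal_zmodClosed J).

Section Quotient.
Context (R : realType) (E : banachLatticeType R) (J : closedIdeal E).
Local Notation Q := (ideal_quotient J).
Implicit Types (x y z : E) (p q r : Q).

HB.instance Definition _ := GRing.Zmodule.on Q.

Definition quotient_proj (x : E) : Q := (\pi_(@Quotient.quot E (ideal_zmodClosed J)) x)%qT.
Local Notation "'pi" := quotient_proj.
Let lift (q : Q) : E := repr (q : @Quotient.quot E (ideal_zmodClosed J)).

Let liftK q : 'pi (lift q) = q.
Proof. exact: reprK. Qed.

Lemma quotient_projE x y : 'pi x = 'pi y <-> J (x - y).
Proof.
rewrite /quotient_proj; split => [/eqP|Jxy].
  by rewrite -Quotient.idealrBE => /asboolP.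
by apply/eqP; rewrite -Quotient.idealrBE; apply/asboolP.
Qed.

Lemma quotient_projD x y : 'pi (x + y) = 'pi x + 'pi y.
Proof. exact: (Quotient.pi_add (ideal_zmodClosed J) x y). Qed.

Lemma quotient_projN x : 'pi (- x) = - 'pi x.
Proof. exact: (Quotient.pi_opp (ideal_zmodClosed J) x). Qed.

Lemma quotient_proj0 : 'pi 0 = 0.
Proof. by rewrite -(subrr (0 : E)) quotient_projD quotient_projN subrr. Qed.

Lemma quotient_proj_surj q : exists x, q = 'pi x.
Proof. by exists (lift q); rewrite liftK. Qed.

Let lift_pi x : J (lift ('pi x) - x).
Proof. by apply/quotient_projE; rewrite liftK. Qed.

Let idealN x : J x -> J (- x).
Proof. by rewrite -scaleN1r; exact: idealZ. Qed.

Let ideal_le x y : 0 <=L x -> x <=L y -> J y -> J x.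
Proof.
move=> x0 xy; apply: ideal_solid; rewrite !ger0_vabs//.
exact: (ble_trans _ _ _ x0).
Qed.

Let ideal_vabs x : J x -> J (vabs x).
Proof. by apply: ideal_solid; rewrite vabs_idem; exact: ble_refl. Qed.

Definition quotient_scale (a : R) (q : Q) : Q := 'pi (a *: lift q).

Let scale_pi a x : quotient_scale a ('pi x) = 'pi (a *: x).
Proof. by apply/quotient_projE; rewrite -scalerBr; exact: idealZ. Qed.

Let scaleA a b q :
  quotient_scale a (quotient_scale b q) = quotient_scale (a * b) q.
Proof. by rewrite /quotient_scale -[LHS]/(quotient_scale a _) scale_pi scalerA. Qed.

Let scale1 : left_id 1 quotient_scale.
Proof. by move=> q; rewrite /quotient_scale scale1r liftK. Qed.

Let scaleDr : right_distributive quotient_scale +%R.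
Proof.
move=> a p q; rewrite -(liftK p) -(liftK q) -quotient_projD !scale_pi.
by rewrite scalerDr quotient_projD.
Qed.

Let scaleDl q : {morph quotient_scale^~ q : a b / a + b}.
Proof. by move=> a b; rewrite /quotient_scale scalerDl quotient_projD. Qed.

HB.instance Definition _ := GRing.Zmodule_isLmodule.Build R Q
  scaleA scale1 scaleDr scaleDl.

Lemma quotient_projZ a x : 'pi (a *: x) = a *: 'pi x.
Proof. by rewrite -scale_pi. Qed.

Let fiber_norms (q : Q) := [set r | exists2 x, 'pi x = q & r = `|x|].

Definition quotient_norm (q : Q) : R := inf (fiber_norms q).

Let fiber_has_inf q : has_inf (fiber_norms q).
Proof.
split; first by exists `|lift q|, (lift q); rewrite ?liftK.
by exists 0 => _ [x _ ->].
Qed.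

Let quotient_norm_le x : quotient_norm ('pi x) <= `|x|.
Proof. by apply: ge_inf; [case: (fiber_has_inf ('pi x))|exists x]. Qed.

Let quotient_norm_lb q a :
  (forall x, 'pi x = q -> a <= `|x|) -> a <= quotient_norm q.
Proof.
move=> h; apply: lb_le_inf; first by case: (fiber_has_inf q).
by move=> _ [x xq ->]; exact: h.
Qed.

Let quotient_norm_lift q (eps : R) : 0 < eps ->
  exists2 x, 'pi x = q & `|x| < quotient_norm q + eps.
Proof.
move=> e0; have [_ [x xq ->] xlt] := inf_adherent e0 (fiber_has_inf q).
by exists x.
Qed.

Let quotient_norm_ge0 q : 0 <= quotient_norm q.
Proof. exact: quotient_norm_lb. Qed.

Let quotient_normD p q :
  quotient_norm (p + q) <= quotient_norm p + quotient_norm q.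
Proof.
apply/ler_addgt0Pr => e e0; have e2 : 0 < e / 2 by rewrite divr_gt0.
have [x xp hx] := quotient_norm_lift p e2.
have [y yq hy] := quotient_norm_lift q e2.
have := quotient_norm_le (x + y); rewrite quotient_projD xp yq.
by have := ler_normD x y; lra.
Qed.

Let quotient_normZ_le a q : quotient_norm (a *: q) <= `|a| * quotient_norm q.
Proof.
apply/ler_addgt0Pr => e e0.
have a0 : 0 < `|a| + 1 by rewrite ltr_wpDl.
have [x xp hx] := quotient_norm_lift q (divr_gt0 e0 a0).
have := quotient_norm_le (a *: x); rewrite quotient_projZ xp normrZ => /le_trans.
apply; apply: (@le_trans _ _ (`|a| * (quotient_norm q + e / (`|a| + 1)))).
  by rewrite ler_wpM2l// ltW.
rewrite mulrDr lerD2l mulrCA ler_piMr ?ltW// ltr_pdivrMr// mul1r.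
by rewrite ltrDl.
Qed.

Let quotient_normZ a q : quotient_norm (a *: q) = `|a| * quotient_norm q.
Proof.
apply/eqP; rewrite eq_le quotient_normZ_le /=.
have [->|a0] := eqVneq a 0; first by rewrite normr0 mul0r quotient_norm_ge0.
have := quotient_normZ_le a^-1 (a *: q).
rewrite scalerA mulVf// scale1r normfV => h.
by rewrite -ler_pdivlMl ?normr_gt0.
Qed.

Let quotient_norm_eq0 q : quotient_norm q = 0 -> q = 0.
Proof.
rewrite -(liftK q) => q0; rewrite -quotient_proj0; apply/quotient_projE.
rewrite subr0; apply: ideal_closed => B /nbhs_normP[e /= e0 eB].
have [x xq] := quotient_norm_lift ('pi (lift q)) e0.
rewrite q0 add0r => hx; exists (lift q - x); split.
  exact/quotient_projE.
by apply: eB; rewrite /= opprB addrC subrK.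
Qed.

HB.instance Definition _ := Lmodule_isNormed.Build R Q
  quotient_normD quotient_normZ quotient_norm_eq0.

Let normQE q : `|q| = quotient_norm q.
Proof. by []. Qed.

Lemma quotient_proj_norm x : `|'pi x| <= `|x|.
Proof. exact: quotient_norm_le. Qed.

Let quotient_complete (F : set_system Q) :
  ProperFilter F -> cauchy F -> cvg F.
Proof.
apply: cauchy_cvg_of_series => u hu.
have e0 n : 0 < (2^-1 : R) ^+ n by rewrite exprn_gt0// invr_gt0.
have /choice[v hv] : forall n, exists x,
    'pi x = u n /\ `|x| <= 2 * 2^-1 ^+ n.
  move=> n; have [x xu hx] := quotient_norm_lift (u n) (e0 n).
  by exists x; split => //; move: (hu n) hx; rewrite normQE; lra.
have vc : cvgn (series v).
  apply: normed_cvg.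
  have gc : cvgn (series (geometric (2 : R) 2^-1)).
    by apply: is_cvg_geometric_series; rewrite ger0_norm ?invr_ge0// invf_lt1// ltr1n.
  by apply: (series_le_cvg _ _ _ gc) => n //=; [rewrite mulr_ge0 // ltW|case: (hv n)].
have [l vl] := (cvg_ex (series v @ \oo)).1 vc.
apply/cvg_ex; exists ('pi l); apply/cvgrPdist_lt => e e_gt0.
have /cvgrPdist_lt/(_ _ e_gt0)[N _ NP] := vl.
exists N => // n Nn /=.
have -> : series u n = 'pi (series v n).
  rewrite /series /=; elim: n {Nn} => [|n IH].
    by rewrite !big_geq// quotient_proj0.
  by rewrite !big_nat_recr//= quotient_projD IH; case: (hv n) => ->.
rewrite -quotient_projN -quotient_projD.
by apply: le_lt_trans (NP n Nn); exact: quotient_proj_norm.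
Qed.

HB.instance Definition _ := Uniform_isComplete.Build Q quotient_complete.

Definition quotient_le (p q : Q) : Prop := J (vpos (lift p - lift q)).
Definition quotient_join (p q : Q) : Q := 'pi (lift p \vee lift q).

Let vpos_mono x y z : x <=L y -> J (vpos y) -> J (vpos x).
Proof. by move=> xy; apply: ideal_le (vpos_ge0 x) (vpos_le xy). Qed.

Let vpos_congr x y : J (x - y) -> J (vpos x) -> J (vpos y).
Proof.
move=> Jxy Jx; apply: (ideal_le (vpos_ge0 y) _ (idealD Jx (ideal_vabs Jxy))).
rewrite -{1}(subrK x y) addrC; apply: (ble_trans _ _ _ (vposD _ _)).
by rewrite -vabsN opprB; apply: bleD; [exact: ble_refl|exact: vpos_vabs].
Qed.

Let le_pi x y : quotient_le ('pi x) ('pi y) <-> J (vpos (x - y)).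
Proof.
have h : J ((lift ('pi x) - lift ('pi y)) - (x - y)).
  have -> : lift ('pi x) - lift ('pi y) - (x - y)
      = (lift ('pi x) - x) - (lift ('pi y) - y).
    by rewrite !opprB addrACA [RHS]addrACA (addrC (- x)).
  by apply: idealD; [exact: lift_pi|apply: idealN; exact: lift_pi].
split; first exact: vpos_congr.
by apply: vpos_congr; rewrite -opprB; exact: idealN.
Qed.

Let join_pi x y : quotient_join ('pi x) ('pi y) = 'pi (x \vee y).
Proof.
apply/quotient_projE; apply: ideal_solid.
  apply: (ble_trans _ _ _ (bjoin_dist _ _ _ _)); rewrite -[X in X <=L _]ger0_vabs.
    exact: ble_refl.
  by rewrite -[0]addr0; apply: bleD; exact: vabs_ge0.
by apply: idealD; apply: ideal_vabs; exact: lift_pi.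
Qed.

Let quotient_le_refl p : quotient_le p p.
Proof.
rewrite /quotient_le subrr; apply: (ideal_le (vpos_ge0 _) _ (ideal0 J)).
by apply/vposP; split; exact: ble_refl.
Qed.

Let quotient_le_anti p q : quotient_le p q -> quotient_le q p -> p = q.
Proof.
move=> pq qp; rewrite -(liftK p) -(liftK q); apply/quotient_projE.
rewrite -(vposB (_ - _)) opprB.
by apply: idealD => //; exact: idealN.
Qed.

Let quotient_le_trans q p r :
  quotient_le p q -> quotient_le q r -> quotient_le p r.
Proof.
move=> pq qr; apply: (ideal_le (vpos_ge0 _) _ (idealD pq qr)).
by rewrite -(subrK (lift q) (lift p)) -addrA; rewrite subrK; exact: vposD.
Qed.

Let quotient_joinP p q r :
  quotient_le (quotient_join p q) r <-> quotient_le p r /\ quotient_le q r.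
Proof.
have [x ->] := quotient_proj_surj p; have [y ->] := quotient_proj_surj q.
have [z ->] := quotient_proj_surj r; rewrite join_pi !le_pi.
split=> [Jxyz|[Jx Jy]].
  split; apply: vpos_mono Jxyz => //; apply: bleD2r.
    exact: bjoinL.
  exact: bjoinR.
apply: (ideal_le (vpos_ge0 _) _ (idealD Jx Jy)); apply/vposP; split; last first.
  by rewrite -[0]addr0; apply: bleD; exact: vpos_ge0.
rewrite -bjoinD; apply/bjoinP; split.
  rewrite -[X in X <=L _]addr0; apply: bleD; [exact: vpos_ge|exact: vpos_ge0].
rewrite -[X in X <=L _]add0r; apply: bleD; [exact: vpos_ge0|exact: vpos_ge].
Qed.

Let quotient_leD2r r p q : quotient_le p q -> quotient_le (p + r) (q + r).
Proof.
have [x ->] := quotient_proj_surj p; have [y ->] := quotient_proj_surj q.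
have [z ->] := quotient_proj_surj r; rewrite -!quotient_projD !le_pi.
by rewrite opprD addrACA subrr addr0.
Qed.

Let quotient_leZ2l (a : R) p q :
  0 <= a -> quotient_le p q -> quotient_le (a *: p) (a *: q).
Proof.
have [x ->] := quotient_proj_surj p; have [y ->] := quotient_proj_surj q.
move=> a0; rewrite -!quotient_projZ !le_pi -scalerBr => Jxy.
apply: (ideal_le (vpos_ge0 _) _ (idealZ a Jxy)); apply/vposP; split.
  by apply: bleZ2l => //; exact: vpos_ge.
by rewrite -(scaler0 _ a); apply: bleZ2l => //; exact: vpos_ge0.
Qed.

Let quotient_le_norm p q :
  quotient_le (quotient_join p (- p)) (quotient_join q (- q)) -> `|p| <= `|q|.
Proof.
have [x ->] := quotient_proj_surj p; have [y0 ->] := quotient_proj_surj q.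
rewrite -!quotient_projN !join_pi => xy0; rewrite [leRHS]normQE.
apply: quotient_norm_lb => y yy0.
have {}yy0 : 'pi (vabs y) = 'pi (vabs y0).
  by rewrite -!join_pi !quotient_projN yy0.
move: xy0; rewrite -[y0 \vee - y0]/(vabs y0) -yy0 le_pi => Jp.
set d := vpos _ in Jp; pose w := vabs y.
have d0 : 0 <=L d by exact: vpos_ge0.
have w0 : 0 <=L w by exact: vabs_ge0.
have : vabs x <=L w + d.
  by rewrite -(bleD2E (- w)) [w + d]addrC addrK; exact: vpos_ge.
move=> /vabsP[xw Nxw].
pose z := (x \wedge w) \vee - w.
have Nww : - w <=L w.
  apply: (@ble_trans _ _ 0) => //.
  by rewrite -oppr0; apply/bleN; rewrite !opprK.
have zw : vabs z <=L vabs y.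
  apply/vabsP; split.
    by apply/bjoinP; split => //; exact: bmeetR.
  by apply/bleN; rewrite opprK; exact: bjoinR.
have Jxz : J (x - z).
  apply: ideal_solid Jp; rewrite (ger0_vabs d0); apply/vabsP; split.
    rewrite -(bleD2E z) subrK addrC -(bleD2E (- d)) addrK.
    apply: (@ble_trans _ _ (x \wedge w)); last exact: bjoinL.
    apply/bmeetP; split; last by rewrite -(bleD2E d) subrK.
    by rewrite -[X in _ <=L X]addr0; apply: bleD; [exact: ble_refl|
      rewrite -oppr0; apply/bleN; rewrite !opprK].
  rewrite opprB -(bleD2E x) subrK addrC; apply/bjoinP; split.
    apply: (@ble_trans _ _ x); first exact: bmeetL.
    by rewrite -[X in X <=L _]addr0; apply: bleD => //; exact: ble_refl.
  by apply/bleN; rewrite opprK opprD -(bleD2E d) subrK.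
have -> : 'pi x = 'pi z by exact/quotient_projE.
by apply: (le_trans (quotient_proj_norm z)); exact: ble_norm.
Qed.

HB.instance Definition _ := CompleteNormedModule_isBanachLattice.Build R Q
  quotient_le_refl quotient_le_anti quotient_le_trans quotient_joinP
  quotient_leD2r quotient_leZ2l quotient_le_norm.

Lemma quotient_proj_le x y : 'pi x <=L 'pi y <-> J (vpos (x - y)).
Proof. exact: le_pi. Qed.

Lemma quotient_proj_join x y : 'pi (x \vee y) = 'pi x \vee 'pi y.
Proof. by rewrite -join_pi. Qed.

Lemma quotient_normE q : `|q| = inf [set r | exists2 x, 'pi x = q & r = `|x|].
Proof. by []. Qed.

End Quotient.

Section EllOnePred.
Context (R : realType).
Implicit Types x y : nat -> R.

Definition summable_seq : {pred nat -> R} :=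
  fun x => `[< cvgn [normed series x] >].

Lemma summable_seqP x : reflect (cvgn [normed series x]) (x \in summable_seq).
Proof. exact: asboolP. Qed.

Let normed_nd x : nondecreasing_seq [normed series x].
Proof. by apply: nondecreasing_series => n _ _; exact: normr_ge0. Qed.

Lemma summable_le_norm x n : x \in summable_seq ->
  \sum_(0 <= i < n) `|x i| <= limn [normed series x].
Proof. move=> /summable_seqP xc; exact: (nondecreasing_cvgn_le (normed_nd x) xc n). Qed.

Lemma summable_bounded x (C : R) : (forall n, \sum_(0 <= i < n) `|x i| <= C) ->
  x \in summable_seq /\ limn [normed series x] <= C.
Proof.
move=> xC; have xc : cvgn [normed series x].
  apply: nondecreasing_is_cvgn => //; exists C => _ [n _ <-]; exact: xC.
split; first exact/summable_seqP.
by apply: limr_le => //; near=> n; exact: xC.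
Unshelve. all: by end_near. Qed.

Let sum_normD x y n : \sum_(0 <= i < n) `|(x + y) i| <=
  \sum_(0 <= i < n) `|x i| + \sum_(0 <= i < n) `|y i|.
Proof. by rewrite -big_split; apply: ler_sum => i _; exact: ler_normD. Qed.

Let sum_normZ (a : R) x n :
  \sum_(0 <= i < n) `|(a *: x) i| = `|a| * \sum_(0 <= i < n) `|x i|.
Proof. by rewrite mulr_sumr; apply: eq_bigr => i _; rewrite normrM. Qed.

Lemma summable_seqD x y : x \in summable_seq -> y \in summable_seq ->
  x + y \in summable_seq /\
  limn [normed series (x + y)] <= limn [normed series x] + limn [normed series y].
Proof.
move=> xs ys; apply: summable_bounded => n; apply: (le_trans (sum_normD _ _ _)).
by apply: lerD; exact: summable_le_norm.
Qed.

Lemma summable_seqZ a x : x \in summable_seq -> a *: x \in summable_seq /\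
  limn [normed series (a *: x)] <= `|a| * limn [normed series x].
Proof.
move=> xs; apply: summable_bounded => n; rewrite sum_normZ.
by apply: ler_wpM2l => //; exact: summable_le_norm.
Qed.

Lemma summable_seq0 : 0 \in summable_seq.
Proof.
have [|//] := @summable_bounded 0 0.
by move=> n; rewrite big1// => i _; rewrite normr0.
Qed.

Let summable_submod : GRing.subsemimod_closed summable_seq.
Proof.
split; first split; first exact: summable_seq0.
  by move=> x y xs ys; have [] := summable_seqD xs ys.
by move=> a x xs; have [] := summable_seqZ a xs.
Qed.

HB.instance Definition _ :=
  GRing.isSubmodClosed.Build R (nat -> R) summable_seq summable_submod.

Record ell1 := Ell1 { ell1_seq :> nat -> R ; _ : ell1_seq \in summable_seq }.

HB.instance Definition _ := [isSub for ell1_seq].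
HB.instance Definition _ := [Choice of ell1 by <:].
HB.instance Definition _ := [SubChoice_isSubLmodule of ell1 by <:].

Implicit Types f g h : ell1.

Let ell1P f : ell1_seq f \in summable_seq. Proof. exact: valP. Qed.

Let ell1_eq f g : (forall i, f i = g i) -> f = g.
Proof. by move=> fg; apply: val_inj; apply/funext. Qed.

Definition ell1_norm f : R := limn [normed series (f : nat -> R)].

Let ell1_norm_le f n : \sum_(0 <= i < n) `|f i| <= ell1_norm f.
Proof. exact: summable_le_norm. Qed.

Let ell1_norm_ub f C : (forall n, \sum_(0 <= i < n) `|f i| <= C) ->
  ell1_norm f <= C.
Proof. by move=> /summable_bounded[]. Qed.

Let ell1_normD f g : ell1_norm (f + g) <= ell1_norm f + ell1_norm g.
Proof. by have [] := summable_seqD (ell1P f) (ell1P g). Qed.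

Let ell1_normZ_le a f : ell1_norm (a *: f) <= `|a| * ell1_norm f.
Proof. by have [] := summable_seqZ a (ell1P f). Qed.

Let ell1_coord_le f i : `|f i| <= ell1_norm f.
Proof.
apply: le_trans (ell1_norm_le f i.+1); rewrite big_nat_recr//= lerDr.
by apply: sumr_ge0 => j _.
Qed.

Let ell1_normZ a f : ell1_norm (a *: f) = `|a| * ell1_norm f.
Proof.
apply/eqP; rewrite eq_le ell1_normZ_le /=.
have [->|a0] := eqVneq a 0.
  by rewrite normr0 mul0r (le_trans _ (ell1_coord_le _ 0%N)).
have := ell1_normZ_le a^-1 (a *: f).
rewrite scalerA mulVf// scale1r normfV => h.
by rewrite -ler_pdivlMl ?normr_gt0.
Qed.

Let ell1_norm_eq0 f : ell1_norm f = 0 -> f = 0.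
Proof.
move=> f0; apply: ell1_eq => i.
by have := ell1_coord_le f i; rewrite f0 normr_le0 => /eqP.
Qed.

HB.instance Definition _ := Lmodule_isNormed.Build R ell1
  ell1_normD ell1_normZ ell1_norm_eq0.

Lemma ell1_normE f : `|f| = limn [normed series (f : nat -> R)].
Proof. by []. Qed.

Let ell1_series_coord (u : nat -> ell1) n i :
  (series u n : ell1) i = series (fun k => u k i) n.
Proof.
rewrite /series /=; elim: n => [|n IH]; first by rewrite !big_geq.
by rewrite !big_nat_recr//= -IH.
Qed.

Let half_sum m n : \sum_(m <= k < n) (2^-1 : R) ^+ k <= 2 * 2^-1 ^+ m.
Proof.
have [nm|mn] := leqP n m.
  by rewrite big_geq// mulr_ge0// exprn_ge0// invr_ge0.
suff -> : \sum_(m <= k < n) (2^-1 : R) ^+ k = 2 * 2^-1 ^+ m - 2 * 2^-1 ^+ n.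
  by rewrite gerBl mulr_ge0// exprn_ge0// invr_ge0.
rewrite -[RHS]opprB -mulrBr -telescope_sumr ?(ltnW mn)// mulr_sumr -sumrN.
by apply: eq_bigr => k _; rewrite exprS; lra.
Qed.

Let cvg_sum_nat (a : nat -> nat -> R) (b : nat -> R) N :
  (forall i, a i @ \oo --> b i) ->
  (fun n => \sum_(0 <= i < N) a i n) @ \oo --> \sum_(0 <= i < N) b i.
Proof.
move=> ab; elim: N => [|N IH].
  by under eq_fun do rewrite big_geq//; rewrite big_geq//; exact: cvg_cst.
by under eq_fun do rewrite big_nat_recr//; rewrite big_nat_recr//; exact: cvgD.
Qed.

Let ell1_complete (F : set_system ell1) : ProperFilter F -> cauchy F -> cvg F.
Proof.
apply: cauchy_cvg_of_series => u hu.
have tail m n N : (m <= n)%N ->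
    \sum_(0 <= i < N) `|series (fun k => u k i) n - series (fun k => u k i) m|
      <= 2 * 2^-1 ^+ m.
  move=> mn; apply: le_trans (half_sum m n).
  apply: (@le_trans _ _ (\sum_(0 <= i < N) \sum_(m <= k < n) `|u k i|)).
    apply: ler_sum => i _; rewrite sub_series_geq//; exact: ler_norm_sum.
  rewrite exchange_big /=; apply: ler_sum => k _.
  by apply: le_trans (hu k); exact: ell1_norm_le.
have cc i : cvgn (series (fun k => u k i)).
  apply: normed_cvg.
  have gc : cvgn (series (geometric (1 : R) 2^-1)).
    by apply: is_cvg_geometric_series; rewrite ger0_norm ?invr_ge0// invf_lt1// ltr1n.
  apply: (series_le_cvg _ _ _ gc) => k //=.
    by rewrite mul1r exprn_ge0// invr_ge0.
  by rewrite mul1r; apply: le_trans (hu k); exact: ell1_coord_le.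
pose x i := limn (series (fun k => u k i)).
have xtail m N : \sum_(0 <= i < N) `|x i - series (fun k => u k i) m|
    <= 2 * 2^-1 ^+ m.
  have cv : (fun n => \sum_(0 <= i < N)
      `|series (fun k => u k i) n - series (fun k => u k i) m|) @ \oo -->
      \sum_(0 <= i < N) `|x i - series (fun k => u k i) m|.
    apply: cvg_sum_nat => i; apply: cvg_norm; apply: cvgB; first exact: cc.
    exact: cvg_cst.
  rewrite -(cvg_lim _ cv)//; apply: limr_le; first by apply/cvg_ex; eexists; exact: cv.
  by exists m => // n /= mn; exact: tail.
have xs : x \in summable_seq.
  have [|//] := @summable_bounded x (2 * 2^-1 ^+ 0) _.
  move=> N; apply: le_trans (xtail 0%N N); apply: ler_sum => i _.
  by rewrite /series /= big_geq// subr0.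
apply/cvg_ex; exists (Ell1 xs); apply/cvgrPdist_lt => e e0.
have [N NP] := half_exp_small (divr_gt0 e0 (ltr0n R 2)).
exists N => // n /= /NP nN; apply: le_lt_trans (_ : 2 * 2^-1 ^+ n < e).
  apply: ell1_norm_ub => K; apply: le_trans (xtail n K).
  by apply: ler_sum => i _ /=; rewrite -ell1_series_coord.
by move: nN; lra.
Qed.

HB.instance Definition _ := Uniform_isComplete.Build ell1 ell1_complete.

Definition ell1_le f g : Prop := forall i, f i <= g i.

Let ell1_join_subproof f g : (fun i => Num.max (f i) (g i)) \in summable_seq.
Proof.
have [|//] := @summable_bounded (fun i => Num.max (f i) (g i))
  (ell1_norm f + ell1_norm g) _.
move=> n; apply: le_trans (lerD (ell1_norm_le f n) (ell1_norm_le g n)).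
rewrite -big_split; apply: ler_sum => i _ /=.
by rewrite /Num.max; case: ifP => _; rewrite (lerDr, lerDl).
Qed.

Definition ell1_join f g : ell1 := Ell1 (ell1_join_subproof f g).

Let ell1_le_refl f : ell1_le f f. Proof. by move=> i. Qed.

Let ell1_le_anti f g : ell1_le f g -> ell1_le g f -> f = g.
Proof. by move=> fg gf; apply: ell1_eq => i; apply/eqP; rewrite eq_le fg gf. Qed.

Let ell1_le_trans g f h : ell1_le f g -> ell1_le g h -> ell1_le f h.
Proof. by move=> fg gh i; exact: le_trans (fg i) (gh i). Qed.

Let ell1_joinP f g h : ell1_le (ell1_join f g) h <-> ell1_le f h /\ ell1_le g h.
Proof.
split=> [fgh|[fh gh] i]; last by rewrite /= ge_max fh gh.
by split=> i; have := fgh i; rewrite /= ge_max => /andP[].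
Qed.

Let ell1_leD2r h f g : ell1_le f g -> ell1_le (f + h) (g + h).
Proof. by move=> fg i; apply: lerD; [exact: fg|]. Qed.

Let ell1_leZ2l (a : R) f g : 0 <= a -> ell1_le f g -> ell1_le (a *: f) (a *: g).
Proof. by move=> a0 fg i; apply: ler_wpM2l => //; exact: fg. Qed.

Let ell1_le_norm f g :
  ell1_le (ell1_join f (- f)) (ell1_join g (- g)) -> `|f| <= `|g|.
Proof.
move=> fg; apply: ell1_norm_ub => n; apply: le_trans (ell1_norm_le g n).
apply: ler_sum => i _; have := fg i; rewrite /=.
by rewrite -!maxrN.
Qed.

HB.instance Definition _ := CompleteNormedModule_isBanachLattice.Build R ell1
  ell1_le_refl ell1_le_anti ell1_le_trans ell1_joinP
  ell1_leD2r ell1_leZ2l ell1_le_norm.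

End EllOnePred.

Section FremlinTensor.
Context (R : realType) (E F : banachLatticeType R).

(* A list [:: (x_1, y_1); ...; (x_n, y_n)] stands for the element
   \sum_k x_k (x) y_k of the algebraic tensor product of E and F; its image
   under the linear map induced by a bilinear map phi is tensor_sum phi u. *)
Definition tensor_sum (G : banachLatticeType R) (phi : {bilinear E -> F -> G})
  (u : seq (E * F)) : G := \sum_(p <- u) phi p.1 p.2.

Definition positive_bilinear (G : banachLatticeType R)
    (phi : {bilinear E -> F -> G}) : Prop :=
  forall x y, 0 <=L x -> 0 <=L y -> 0 <=L phi x y.

Definition contractive_bilinear (G : banachLatticeType R)
    (phi : {bilinear E -> F -> G}) : Prop :=
  forall x y, `|x| <= 1 -> `|y| <= 1 -> `|phi x y| <= 1.

(* The set is nonempty (phi = 0) and bounded above by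
   \sum_(p <- u) `|p.1| * `|p.2|, so that sup is its least upper bound. *)
Definition fremlin_norm (u : seq (E * F)) : R :=
  sup [set r | exists (G : banachLatticeType R) (phi : {bilinear E -> F -> G}),
    [/\ positive_bilinear phi, contractive_bilinear phi
      & r = `|tensor_sum phi u|]].

(* A realization of the completion of the algebraic tensor product for
   fremlin_norm, ordered by the closure of the cone generated by the tensors
   of positive vectors. These data determine it up to a unique isometric order
   isomorphism carrying elementary tensors to elementary tensors. *)
Record fremlinTensor := FremlinTensor {
  fremlin_space :> banachLatticeType R ;
  tens : {bilinear E -> F -> fremlin_space} ;
  tens_norm : forall u, `|tensor_sum tens u| = fremlin_norm u ;
  tens_dense : closure (range (tensor_sum tens)) = setT ;
  tens_ge0 : forall t : fremlin_space, 0 <=L t <->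
    closure [set tensor_sum tens u | u in
      [set u | forall p, p \in u -> 0 <=L p.1 /\ 0 <=L p.2]] t
}.

End FremlinTensor.

Definition orthosymmetric_ideal (R : realType) (E : banachLatticeType R)
    (T : fremlinTensor E E) : closedIdeal T :=
  ideal_gen [set t : T | exists x y : E, disjoint_vec x y /\ t = tens T x y].

Section Bases.
Context (R : realType) (E : banachLatticeType R) (e : nat -> E).

Definition schauder_basis : Prop := forall x : E,
  exists! a : nat -> R, series (fun i => a i *: e i) @ \oo --> x.

Definition basis_defines_order : Prop := forall (x : E) (a : nat -> R),
  series (fun i => a i *: e i) @ \oo --> x -> (0 <=L x <-> forall i, 0 <= a i).

Definition normalized : Prop := forall i, `|e i| = 1.

End Bases.

Definition lower_2_estimate (R : realType) (E : banachLatticeType R) (M : R) :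
    Prop :=
  forall (n : nat) (x : 'I_n -> E),
    (forall i j, i != j -> disjoint_vec (x i) (x j)) ->
    M^-1 * Num.sqrt (\sum_(k < n) `|x k| ^+ 2) <= `|\sum_(k < n) x k|.

Section LatticeIsomorphism.
Context (R : realType) (E F : banachLatticeType R) (f : E -> F).

(* Preservation of infima follows from linearity, since
   x \wedge y = - (- x \vee - y). *)
Definition lattice_homomorphism : Prop :=
  linear f /\ (forall x y, f (x \vee y) = f x \vee f y).

Definition lattice_isomorphism : Prop :=
  [/\ lattice_homomorphism, bijective f
    & exists c C : R, 0 < c /\ forall x, c * `|x| <= `|f x| <= C * `|x|].

Definition lattice_isometry : Prop :=
  lattice_isomorphism /\ forall x, `|f x| = `|x|.

End LatticeIsomorphism.

(* Main.v *)
(* Coordinatewise multiplication psi (x, y) = (x_i y_i) maps E x E into ell_1: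
   the e_i being disjoint, the lower 2-estimate gives
   \sum_i x_i^2 <= M^2 |x|^2, and 2 |x_i y_i| <= x_i^2 + y_i^2. Hence M^-2 psi
   is positive and contractive and psi induces a positive operator D of norm at
   most M^2 on the tensor product. The vectors t with D |t| = 0 form a closed
   ideal containing all x (x) y with x, y disjoint, so D factors through the
   quotient by I_oc. The factored map is inverse to Phi: one composition is
   computed on the e_i, the other by density from t = e_i (x) e_j, where
   t - \sum_k (D t)_k e_k (x) e_k lies in I_oc. Both maps are positive, hence
   Phi is an order isomorphism and in particular preserves suprema. *)
From HB Require Import structures.
Require Import Defs.
From mathcomp Require Import all_boot all_order all_algebra sesquilinear.
From mathcomp Require Import all_classical all_reals topology normedtype sequences.
From mathcomp Require Import lra.

Set Implicit Arguments.
Unset Strict Implicit.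
Unset Printing Implicit Defensive.

Import Order.TTheory GRing.Theory Num.Theory.
Import numFieldNormedType.Exports.

Local Open Scope classical_set_scope.
Local Open Scope ring_scope.

(** * Order, norm and the positive cone in a Banach lattice *)

Section BanachLatticeFacts.
Context {R : realType} {E : banachLatticeType R}.
Implicit Types x y : E.

Lemma vabs_le_norm x y : vabs x <=L y -> `|x| <= `|y|.
Proof. by move=> xy; apply: ble_norm; apply: (ble_trans _ _ _ xy); exact: vabs_ler. Qed.

Lemma ble0D x y : 0 <=L x -> 0 <=L y -> 0 <=L x + y.
Proof. by move=> x0 y0; rewrite -[0]addr0; exact: bleD. Qed.

Lemma ble0Z (a : R) x : 0 <= a -> 0 <=L x -> 0 <=L a *: x.
Proof. by move=> a0 x0; rewrite -(scaler0 _ a); exact: bleZ2l. Qed.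

(** As [- x <=L y - x] for [y] in the cone, the negative part of [x] is dominated by [vabs (y - x)].
    Its norm thus bounds the distance from [x] to the cone from below, which makes the cone
    closed. *)
Lemma vposN_norm x y : 0 <=L y -> `|vpos (- x)| <= `|x - y|.
Proof.
move=> y0; rewrite -(normrN (x - y)) opprB; apply: ble_norm.
rewrite -[X in X <=L _]/(vabs (vpos (- x))) (ger0_vabs (vpos_ge0 _)).
apply/vposP; split; last exact: vabs_ge0.
apply: (@ble_trans _ _ (y - x)); last exact: vabs_ler.
by rewrite -[X in X <=L _]add0r; exact: bleD2r.
Qed.

Lemma vposN_eq0 x : vpos (- x) = 0 -> 0 <=L x.
Proof. by move=> x0; rewrite -(vposB x) x0 subr0; exact: vpos_ge0. Qed.

Lemma closed_ge0 : closed [set x : E | 0 <=L x].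
Proof.
move=> x clx; apply: vposN_eq0; apply/eqP; rewrite -normr_le0.
apply/ler_addgt0Pr => eps eps0; rewrite add0r.
have [y [/= y0]] := clx _ (nbhsx_ballx x eps eps0).
rewrite -ball_normE /= => /ltW; apply: le_trans; exact: vposN_norm.
Qed.

Lemma scale_vabs (a : R) x : 0 <=L x -> vabs (a *: x) = `|a| *: x.
Proof.
move=> x0; have [a0|a0] := ger0P a; first by rewrite ger0_vabs//; exact: ble0Z.
by rewrite -vabsN -scaleNr ger0_vabs//; apply: ble0Z => //; rewrite oppr_ge0 ltW.
Qed.

End BanachLatticeFacts.

(** * Positive and contractive bilinear maps *)

(** With [a = vabs x] and [b = vabs y], the difference of the two sides is the average of
    [phi (a - x) (b + y)] and [phi (a + x) (b - y)], both positive. *)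
Lemma bilinear_le_vabs (R : realType) (E F G : banachLatticeType R)
    (phi : {bilinear E -> F -> G}) (x : E) (y : F) :
  positive_bilinear phi -> phi x y <=L phi (vabs x) (vabs y).
Proof.
move=> phi0; pose a := vabs x; pose b := vabs y.
have pos (z w : G) : 0 <=L z + w -> 0 <=L z - w -> 0 <=L z.
  move=> zw1 zw2; rewrite -[z](scalerK (_ : 2 != 0 :> R)) ?pnatr_eq0//.
  apply: ble0Z; first by rewrite invr_ge0.
  by rewrite scaler_nat mulr2n -{1}(addrK w z) addrAC -addrA; exact: ble0D.
have Dx : 0 <=L a - x by rewrite -ble_subr; exact: vabs_ler.
have Sx : 0 <=L a + x by rewrite -(opprK x) -ble_subr; exact: vabs_lerN.
have Dy : 0 <=L b - y by rewrite -ble_subr; exact: vabs_ler.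
have Sy : 0 <=L b + y by rewrite -(opprK y) -ble_subr; exact: vabs_lerN.
rewrite ble_subr; apply: (pos _ (phi a y - phi x b)).
  have -> : phi a b - phi x y + (phi a y - phi x b) = phi (a - x) (b + y).
    by rewrite linearBl !linearDr opprD addrACA [- _ - _]addrC.
  exact: phi0.
have -> : phi a b - phi x y - (phi a y - phi x b) = phi (a + x) (b - y).
  by rewrite linearDl !linearBr opprB [phi x b - phi a y]addrC addrACA
    [- phi x y + _]addrC.
exact: phi0.
Qed.

Lemma bilinear_vabs (R : realType) (E F G : banachLatticeType R)
    (phi : {bilinear E -> F -> G}) (x : E) (y : F) :
  positive_bilinear phi -> vabs (phi x y) <=L phi (vabs x) (vabs y).
Proof.
move=> phi0; apply/vabsP; split; first exact: bilinear_le_vabs.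
by rewrite -linearNl -(vabsN x); exact: bilinear_le_vabs.
Qed.

Lemma contractive_bilinear_norm (R : realType) (E F G : banachLatticeType R)
    (phi : {bilinear E -> F -> G}) (x : E) (y : F) :
  contractive_bilinear phi -> `|phi x y| <= `|x| * `|y|.
Proof.
move=> phi1; have [->|x0] := eqVneq x 0; first by rewrite linear0l !normr0 mul0r.
have [->|y0] := eqVneq y 0; first by rewrite linear0r !normr0 mulr0.
have unit (V : banachLatticeType R) (v : V) : v != 0 -> `| `|v|^-1 *: v| <= 1.
  by move=> v0; rewrite normrZ normfV normr_id mulVf// normr_eq0.
have := phi1 _ _ (unit _ _ x0) (unit _ _ y0).
rewrite linearZl_LR linearZr_LR /= !normrZ !normfV !normr_id.
by rewrite ler_pdivrMl ?normr_gt0// mulr1 ler_pdivrMl ?normr_gt0// mulrC.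
Qed.

(** * Formal sums of elementary tensors and the Fremlin norm *)

Section TensorOperator.
Context (R : realType) (E F G : banachLatticeType R).
Implicit Types (u v : seq (E * F)) (phi : {bilinear E -> F -> G}).

Definition scale_tensor (a : R) u := [seq (a *: p.1, p.2) | p <- u].

Lemma tensor_sum_cat (H : banachLatticeType R) (phi : {bilinear E -> F -> H}) u v :
  tensor_sum phi (u ++ v) = tensor_sum phi u + tensor_sum phi v.
Proof. exact: big_cat. Qed.

Lemma tensor_sum_scale (H : banachLatticeType R) (phi : {bilinear E -> F -> H}) a u :
  tensor_sum phi (scale_tensor a u) = a *: tensor_sum phi u.
Proof.
rewrite /tensor_sum big_map scaler_sumr; apply: eq_bigr => p _.
by rewrite linearZl_LR.
Qed.

Lemma tensor_sum1 (H : banachLatticeType R) (phi : {bilinear E -> F -> H}) x y :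
  tensor_sum phi [:: (x, y)] = phi x y.
Proof. exact: big_seq1. Qed.

Lemma fremlin_norm_ge phi u : positive_bilinear phi -> contractive_bilinear phi ->
  `|tensor_sum phi u| <= fremlin_norm u.
Proof.
move=> phi0 phi1; apply: ub_le_sup; last by exists G, phi.
exists (\sum_(p <- u) `|p.1| * `|p.2|) => _ [H [psi [_ psi1 ->]]].
apply: le_trans (ler_norm_sum _ _ _) _; apply: ler_sum => p _.
exact: contractive_bilinear_norm.
Qed.

End TensorOperator.

(** * Positivity, cross-norm bound and density of elementary tensors *)

Section TensorProduct.
Context (R : realType) (E F : banachLatticeType R) (T : fremlinTensor E F).

Lemma tens_positive : positive_bilinear (tens T).
Proof.
move=> x y x0 y0; apply/tens_ge0; apply: subset_closure.
exists [:: (x, y)]; last exact: tensor_sum1.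
by move=> p; rewrite inE => /eqP ->.
Qed.

Lemma norm_tens x y : `|tens T x y| <= `|x| * `|y|.
Proof.
rewrite -tensor_sum1 tens_norm /fremlin_norm; set A := [set r | _].
(* The supremum of the empty set is 0 by convention, so this case is harmless. *)
have [->|/set0P A0] := eqVneq A set0; first by rewrite sup0 mulr_ge0.
apply: ge_sup => //.
move=> _ [H [psi [_ psi1 ->]]]; rewrite tensor_sum1.
exact: contractive_bilinear_norm.
Qed.

Lemma tens_dense_ball (t : T) (eps : R) : 0 < eps ->
  exists u, `|t - tensor_sum (tens T) u| < eps.
Proof.
move=> eps0; have : closure (range (tensor_sum (tens T))) t by rewrite tens_dense.
move=> /(_ _ (nbhsx_ballx t eps eps0))[_ [[u _ <-]]]; rewrite -ball_normE.
by exists u.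
Qed.

End TensorProduct.

(** * Scalar multiples of bilinear maps *)

Section ScaleBilinear.
Context (R : realType) (E F G : banachLatticeType R) (a : R)
  (phi : {bilinear E -> F -> G}).

Definition scale_bilinear (x : E) (y : F) : G := a *: phi x y.

Let scale_bilinear_bilinear : bilinear_for
  (GRing.Scale.Law.clone _ _ *:%R _) (GRing.Scale.Law.clone _ _ *:%R _)
  scale_bilinear.
Proof.
split=> [y|x] b z w; rewrite /scale_bilinear /=.
  by rewrite linearDl linearZl_LR scalerDr !scalerA mulrC.
by rewrite linearDr linearZr_LR scalerDr !scalerA mulrC.
Qed.

HB.instance Definition _ := bilinear_isBilinear.Build R E F G _ _ scale_bilinear
  scale_bilinear_bilinear.

End ScaleBilinear.

(** * Extension of bounded bilinear maps to the completed tensor product *)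

Section UniversalProperty.
Context (R : realType) (E F G : banachLatticeType R) (T : fremlinTensor E F).
Context (phi : {bilinear E -> F -> G}) (C : R).

(** The map [C^-1 *: phi] is contractive, so it competes in the supremum defining [fremlin_norm]. *)
Lemma tensor_sum_le : 0 < C -> positive_bilinear phi ->
  (forall x y, `|x| <= 1 -> `|y| <= 1 -> `|phi x y| <= C) ->
  forall u, `|tensor_sum phi u| <= C * `|tensor_sum (tens T) u|.
Proof.
move=> C0 phi0 phiC u; rewrite tens_norm.
have E1 : tensor_sum (scale_bilinear C^-1 phi) u = C^-1 *: tensor_sum phi u.
  by rewrite /tensor_sum scaler_sumr.
have Ci : 0 <= C^-1 by rewrite invr_ge0 ltW.
rewrite -ler_pdivrMl// -{1}(ger0_norm Ci) -normrZ -E1.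
apply: fremlin_norm_ge => x y.
  by move=> x0 y0; apply: ble0Z => //; exact: phi0.
move=> x1 y1; rewrite normrZ normfV (ger0_norm (ltW C0)).
by rewrite ler_pdivrMl// mulr1; exact: phiC.
Qed.


Context (C0 : 0 < C)
  (phiC : forall u, `|tensor_sum phi u| <= C * `|tensor_sum (tens T) u|).

(** The difference is the value of [phi] on the list [scale_tensor (- 1) v ++ u] up to order, whose
    tensor has norm at most the sum of the two distances to [t]. *)
Let approx_dist u v (t : T) : `|tensor_sum phi u - tensor_sum phi v| <=
  C * (`|t - tensor_sum (tens T) u| + `|t - tensor_sum (tens T) v|).
Proof.
rewrite -[X in _ - X]scale1r -scaleNr -tensor_sum_scale -tensor_sum_cat.
apply: le_trans (phiC _) _; apply: ler_wpM2l; first exact: ltW.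
rewrite tensor_sum_cat tensor_sum_scale scaleN1r addrC; set a := tensor_sum _ u.
set b := tensor_sum _ v; rewrite [leRHS]addrC; apply: le_trans (ler_normB _ _).
by rewrite opprB [t - b + _]addrC addrA subrK addrC.
Qed.

(** The value [l] is the limit of [phi] along tensors converging to [t]. Quantifying over all [u]
    makes the estimate independent of the chosen sequence. *)
Let extension_point (t : T) : exists l : G, forall u,
  `|l - tensor_sum phi u| <= C * `|t - tensor_sum (tens T) u|.
Proof.
have h0 n : 0 < (2^-1 : R) ^+ n by rewrite exprn_gt0// invr_gt0.
have /choice[u ut] : forall n, exists u, `|t - tensor_sum (tens T) u| < 2^-1 ^+ n.
  by move=> n; exact: tens_dense_ball.
have /cvg_ex[l ul] : cvgn (fun n => tensor_sum phi (u n)).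
  apply: cauchy_cvg; apply: cauchy_exP => eps eps0.
  (* Two tensors this close to [t] have images within [eps] of each other. *)
  have e2 : 0 < eps / C / 2 by rewrite !divr_gt0.
  have [n nP] := half_exp_small e2.
  exists (tensor_sum phi (u n)); exists n => // m /= nm.
  rewrite -ball_normE /=; apply: le_lt_trans (approx_dist _ _ t) _.
  have := ltrD (lt_trans (ut n) (nP n (leqnn n))) (lt_trans (ut m) (nP m nm)).
  by rewrite -splitr -ltr_pdivlMl// [C^-1 * _]mulrC.
exists l => v; apply/ler_addgt0Pr => eps eps0.
have e2 : 0 < eps / C / 2 by rewrite !divr_gt0.
have [n1 n1P] := half_exp_small e2.
have /cvgrPdist_lt/(_ _ (divr_gt0 eps0 (ltr0n _ 2)))[n2 _ n2P] := ul.
pose m := maxn n1 n2.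
have hm := n2P m (leq_maxr _ _).
have := lt_trans (ut m) (n1P m (leq_maxl _ _)).
rewrite mulrAC [_ / C]mulrC ltr_pdivlMl// => ut2.
rewrite -(subrK (tensor_sum phi (u m)) l) -addrA.
apply: le_trans (ler_normD _ _) _.
have := approx_dist (u m) v t; rewrite mulrDr.
by move: hm ut2 => /=; lra.
Qed.

Lemma tensor_extension : exists D : {linear T -> G}, [/\
  forall x y, D (tens T x y) = phi x y,
  forall t, `|D t| <= C * `|t|
  & positive_bilinear phi -> forall t, 0 <=L t -> 0 <=L D t].
Proof.
have [D DP] := choice extension_point.
(* Identification criterion: [D t = l] once one and the same [u] approximates [t] and has its image
   near [l]. It gives both linearity and the values on elementary tensors. *)
have D0 l t : (forall eps, 0 < eps -> exists2 u,
    `|t - tensor_sum (tens T) u| <= eps & `|l - tensor_sum phi u| <= eps) ->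
  D t = l.
  move=> lt; apply/eqP; rewrite -subr_eq0 -normr_le0; apply/ler_addgt0Pr => eps eps0.
  have C1 : 0 < C + 1 by rewrite ltr_wpDr.
  have [u tu lu] := lt (eps / (C + 1)) (divr_gt0 eps0 C1).
  rewrite add0r -(subrK (tensor_sum phi u) (D t)) -addrA.
  apply: le_trans (ler_normD _ _) _; rewrite [X in _ + X]distrC.
  apply: le_trans (lerD (le_trans (DP _ _) (ler_wpM2l (ltW C0) tu)) lu) _.
  by rewrite -[X in _ + X <= _]mul1r -mulrDl mulrC divfK// gt_eqF.
have Dlin : linear D.
  move=> a s t; apply: D0 => eps eps0.
  have a1 : 0 < `|a| + 1 by rewrite ltr_wpDl.
  have C1 : 0 < C + 1 by rewrite ltr_wpDr.
  (* Forming [a *: s + t] costs a factor |a| + 1, and passing through [D] a factor [C]. *)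
  have e1 : 0 < eps / (`|a| + 1) / (C + 1) by rewrite !divr_gt0.
  have [u su] := tens_dense_ball s e1; have [v tv] := tens_dense_ball t e1.
  have aux (H : banachLatticeType R) (psi : {bilinear E -> F -> H}) x y d :
    `|x - tensor_sum psi u| <= d -> `|y - tensor_sum psi v| <= d ->
    `|a *: x + y - tensor_sum psi (scale_tensor a u ++ v)| <= (`|a| + 1) * d.
    move=> xd yd; rewrite tensor_sum_cat tensor_sum_scale opprD addrACA -scalerBr.
    apply: le_trans (ler_normD _ _) _; rewrite normrZ mulrDl mul1r.
    by apply: lerD => //; exact: ler_wpM2l.
  exists (scale_tensor a u ++ v).
    apply: le_trans (aux _ _ _ _ _ (ltW su) (ltW tv)) _.
    rewrite mulrA mulrCA divff ?gt_eqF// mulr1 ler_pdivrMr//.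
    by apply: ler_peMr; [exact: ltW|rewrite lerDr ltW].
  have DC x w : `|x - tensor_sum (tens T) w| < eps / (`|a| + 1) / (C + 1) ->
      `|D x - tensor_sum phi w| <= eps / (`|a| + 1).
    move=> /ltW xw; apply: le_trans (DP _ _) _.
    apply: le_trans (ler_wpM2l (ltW C0) xw) _.
    rewrite mulrCA; apply: ler_piMr; first by rewrite divr_ge0// ltW.
    by rewrite ler_pdivrMr// mul1r lerDl.
  apply: le_trans (aux _ _ _ _ _ (DC _ _ su) (DC _ _ tv)) _.
  by rewrite mulrC divfK// gt_eqF.
pose L : {linear T -> G} := HB.pack D (GRing.isLinear.Build R T G *:%R D Dlin).
exists L; split.
- move=> x y; apply: D0 => eps eps0; exists [:: (x, y)];
  by rewrite tensor_sum1 subrr normr0 ltW.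
(* The empty list represents 0, so the norm bound is a case of [DP]. *)
- by move=> t; have := DP t [::]; rewrite /tensor_sum !big_nil !subr0.
(* A positive [t] is a limit of sums of positive elementary tensors; their images are positive and
   the cone of [G] is closed. *)
- move=> phi0 t /tens_ge0 t0; apply: closed_ge0 => B /nbhs_normP[eps /= eps0 epsB].
  have := t0 _ (nbhsx_ballx t _ (divr_gt0 eps0 C0)).
  move=> [_ [[u u0 <-]]]; rewrite -ball_normE /= => tu.
  exists (tensor_sum phi u); split; last first.
    by apply: epsB => /=; apply: le_lt_trans (DP _ _) _; rewrite -ltr_pdivlMl// mulrC.
  rewrite /tensor_sum; elim: u u0 {tu} => [|p u IH] u0.
    by rewrite big_nil; exact: ble_refl.
  rewrite big_cons; apply: ble0D.
    by have [|] := u0 p; [rewrite mem_head|exact: phi0].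
  by apply: IH => q qu; apply: u0; rewrite inE qu orbT.
Qed.

End UniversalProperty.

(** * Coordinates in the basis and the coordinatewise product *)

Section BasisCoordinates.
Context {R : realType} {E : banachLatticeType R} {e : nat -> E}.
Context (eB : schauder_basis e).

Definition basis_coord (x : E) : nat -> R := sval (cid (eB x)).

Lemma basis_coord_cvg x : series (fun i => basis_coord x i *: e i) @ \oo --> x.
Proof. by rewrite /basis_coord; case: cid => a []. Qed.

Lemma basis_coord_unique x a : series (fun i => a i *: e i) @ \oo --> x ->
  basis_coord x = a.
Proof. by rewrite /basis_coord; case: cid => b [bx buniq] /buniq. Qed.

Lemma basis_coordP a x y i :
  basis_coord (a *: x + y) i = a * basis_coord x i + basis_coord y i.
Proof.
rewrite (@basis_coord_unique _ (fun i => a * basis_coord x i + basis_coord y i))//.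
rewrite (_ : series _ = fun n => a *: series (fun i => basis_coord x i *: e i) n +
  series (fun i => basis_coord y i *: e i) n).
  by apply: cvgD; [apply: cvgZr|]; exact: basis_coord_cvg.
apply/funext => n; rewrite /series /= scaler_sumr -big_split /=.
by apply: eq_bigr => k _; rewrite scalerDl scalerA.
Qed.

Lemma basis_coord0 i : basis_coord 0 i = 0.
Proof.
have := basis_coordP 1 0 0 i; rewrite scale1r addr0 mul1r => h.
by apply: (addrI (basis_coord 0 i)); rewrite -h addr0.
Qed.

Lemma basis_coordD x y i : basis_coord (x + y) i = basis_coord x i + basis_coord y i.
Proof. by rewrite -[x]scale1r basis_coordP scale1r mul1r. Qed.

Lemma basis_coordZ a x i : basis_coord (a *: x) i = a * basis_coord x i.
Proof. by rewrite -[a *: x]addr0 basis_coordP basis_coord0 addr0. Qed.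

Lemma basis_coordN x i : basis_coord (- x) i = - basis_coord x i.
Proof. by rewrite -scaleN1r basis_coordZ mulN1r. Qed.

Lemma basis_coord_basis j i : basis_coord (e j) i = (i == j)%:R.
Proof.
rewrite (@basis_coord_unique _ (fun i => (i == j)%:R))//.
apply: cvg_near_cst; exists j.+1 => // n /= jn.
rewrite /series /= (bigD1_seq j) ?mem_index_iota ?iota_uniq//= eqxx scale1r.
by rewrite big1 ?addr0// => k /negPf ->; rewrite scale0r.
Qed.

Lemma basis_coord_sum n a i :
  basis_coord (\sum_(0 <= k < n) a k *: e k) i = if (i < n)%N then a i else 0.
Proof.
elim: n => [|n IH]; first by rewrite big_geq// basis_coord0.
rewrite big_nat_recr//= basis_coordD IH basis_coordZ basis_coord_basis ltnS.
have [->|ni] := eqVneq i n; first by rewrite ltnn leqnn mulr1 add0r.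
by rewrite mulr0 addr0 [(i <= n)%N]leq_eqVlt (negPf ni).
Qed.

(** Induction principle for passing from the [e i] to all of [E], to be used in one tensor factor at
    a time. *)
Lemma basis_span_closed (A : set E) : closed A -> A 0 ->
  (forall a x y, A x -> A y -> A (a *: x + y)) -> (forall i, A (e i)) -> forall x, A x.
Proof.
move=> Acl A0 Alin Ae x; apply: (closed_cvg A Acl _ _ (@basis_coord_cvg x)).
apply: nearW => n; rewrite /series /=; elim: n => [|n IH]; first by rewrite big_geq.
by rewrite big_nat_recr//= addrC; exact: Alin.
Qed.

Definition basis_proj n (x : E) := \sum_(0 <= k < n) basis_coord x k *: e k.

Context (e0 : basis_defines_order e).

Lemma ble_basis_coord x y :
  x <=L y <-> forall i, basis_coord x i <= basis_coord y i.
Proof.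
rewrite ble_subr (e0 (@basis_coord_cvg (y - x))).
by split=> h i; move: (h i); rewrite basis_coordD basis_coordN subr_ge0.
Qed.

Lemma basis_ge0 i : 0 <=L e i.
Proof. by apply/ble_basis_coord => j; rewrite basis_coord0 basis_coord_basis. Qed.

(** Truncation replaces coordinates by 0, which stays below the coordinates of [vabs x]; hence both
    [basis_proj n x] and its opposite are dominated by [vabs x]. *)
Lemma basis_proj_norm n x : `|basis_proj n x| <= `|x|.
Proof.
have le (z : E) : z <=L vabs x -> basis_proj n z <=L vabs x.
  move=> /ble_basis_coord zx; apply/ble_basis_coord => i; rewrite basis_coord_sum.
  case: ifP => // _; have /ble_basis_coord/(_ i) := vabs_ge0 x.
  by rewrite basis_coord0.
have projN : basis_proj n (- x) = - basis_proj n x.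
  by rewrite -sumrN; apply: eq_bigr => k _; rewrite basis_coordN scaleNr.
apply: ble_norm; apply/vabsP; split; first by apply: le; exact: vabs_ler.
by rewrite -projN; apply: le; exact: vabs_lerN.
Qed.

Lemma disjoint_vec_basis (a b : R) i j :
  i != j -> disjoint_vec (a *: e i) (b *: e j).
Proof.
move=> ij; rewrite /disjoint_vec !scale_vabs; [|exact: basis_ge0..].
apply: ble_anti; last by apply/bmeetP; split; apply: ble0Z => //; exact: basis_ge0.
apply/ble_basis_coord => k; rewrite basis_coord0.
have /ble_basis_coord/(_ k) := bmeetL (`|a| *: e i) (`|b| *: e j).
have /ble_basis_coord/(_ k) := bmeetR (`|a| *: e i) (`|b| *: e j).
rewrite !basis_coordZ !basis_coord_basis.
by have [->|_] := eqVneq k i; rewrite ?(negPf ij) !mulr0.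
Qed.

(** If [m] is the smaller of the two coordinates, [m *: e i] lies below both absolute values, hence
    below their meet 0, so [m <= 0]. *)
Lemma disjoint_vec_coord x y i : disjoint_vec x y ->
  basis_coord (vabs x) i * basis_coord (vabs y) i = 0.
Proof.
move=> xy; pose m := Num.min (basis_coord (vabs x) i) (basis_coord (vabs y) i).
have c0 z : 0 <= basis_coord (vabs z) i.
  by have /ble_basis_coord/(_ i) := vabs_ge0 z; rewrite basis_coord0.
have le z : m <= basis_coord (vabs z) i -> m *: e i <=L vabs z.
  move=> mz; apply/ble_basis_coord => k; rewrite basis_coordZ basis_coord_basis.
  have [->|_] := eqVneq k i; first by rewrite mulr1.
  by rewrite mulr0; have /ble_basis_coord/(_ k) := vabs_ge0 z; rewrite basis_coord0.
have : m *: e i <=L 0.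
  by rewrite -xy; apply/bmeetP; split; apply: le; rewrite ge_min lexx ?orbT.
move=> /ble_basis_coord/(_ i).
rewrite basis_coordZ basis_coord_basis eqxx mulr1 basis_coord0 ge_min.
by move=> /orP[] h; [rewrite (_ : basis_coord (vabs x) i = 0) ?mul0r
  |rewrite (_ : basis_coord (vabs y) i = 0) ?mulr0]; try (apply/eqP; rewrite eq_le h c0).
Qed.

Context (M : R) (M0 : 0 < M) (e1 : normalized e) (E2 : lower_2_estimate E M).

(** The lower estimate applies to the disjoint terms of [basis_proj n x], whose norm is at most that
    of [x]. *)
Lemma sum_sqr_basis_coord n x :
  \sum_(0 <= k < n) basis_coord x k ^+ 2 <= M ^+ 2 * `|x| ^+ 2.
Proof.
have := @E2 n (fun k => basis_coord x k *: e k) _.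
rewrite -(big_mkord xpredT (fun k => basis_coord x k *: e k)).
rewrite -(big_mkord xpredT (fun k => `|basis_coord x k *: e k| ^+ 2)).
under eq_bigr do rewrite normrZ e1 mulr1 real_normK ?num_real//.
set S := \sum_(0 <= k < n) basis_coord x k ^+ 2 => h.
have {}h : Num.sqrt S <= M * `|x|.
  rewrite -ler_pdivrMl//; apply: le_trans (basis_proj_norm n x); apply: h.
  by move=> i j ij; exact: disjoint_vec_basis.
have S0 : 0 <= S by apply: sumr_ge0 => k _; exact: sqr_ge0.
by rewrite -exprMn -(sqr_sqrtr S0) ler_sqr ?nnegrE ?sqrtr_ge0 ?mulr_ge0 ?(ltW M0).
Qed.

Lemma sum_basis_coordM n x y :
  \sum_(0 <= k < n) `|basis_coord x k * basis_coord y k|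
    <= M ^+ 2 * ((`|x| ^+ 2 + `|y| ^+ 2) / 2).
Proof.
rewrite mulrA mulrDr ler_pdivlMr// mulrC mulr_sumr.
apply: le_trans (lerD (sum_sqr_basis_coord n x) (sum_sqr_basis_coord n y)).
rewrite -big_split; apply: ler_sum => k _ /=; rewrite normrM.
rewrite -[basis_coord x k ^+ 2]real_normK ?num_real//.
rewrite -[basis_coord y k ^+ 2]real_normK ?num_real//.
by have := sqr_ge0 (`|basis_coord x k| - `|basis_coord y k|); rewrite sqrrB; lra.
Qed.

Let diagonal_subproof x y :
  (fun k => basis_coord x k * basis_coord y k) \in @summable_seq R.
Proof. by have [] := summable_bounded (fun n => sum_basis_coordM n x y). Qed.

Definition diagonal_product (x y : E) : ell1 R := Ell1 (diagonal_subproof x y).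

Lemma diagonal_product_bilinear : bilinear_for
  (GRing.Scale.Law.clone _ _ *:%R _) (GRing.Scale.Law.clone _ _ *:%R _)
  diagonal_product.
Proof.
split=> [y|x] a z w; apply: val_inj; apply/funext => k /=; rewrite basis_coordP.
  by rewrite mulrDl -mulrA.
by rewrite mulrDr mulrCA.
Qed.

Lemma diagonal_product_norm x y :
  `|diagonal_product x y| <= M ^+ 2 * ((`|x| ^+ 2 + `|y| ^+ 2) / 2).
Proof. by have [] := summable_bounded (fun n => sum_basis_coordM n x y). Qed.

End BasisCoordinates.

(** * Lipschitz maps and order isomorphisms *)

Lemma lipschitz_continuous (R : realType) (V W : normedModType R)
    (f : V -> W) (C : R) :
  (forall x y, `|f x - f y| <= C * `|x - y|) -> continuous f.
Proof.
move=> fC x; apply/cvgrPdist_lt => eps eps0.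
(* [C] may be zero or negative, so |C| + 1 serves as the divisor. *)
have C1 : 0 < `|C| + 1 by rewrite ltr_wpDl.
apply/nbhs_normP; exists (eps / (`|C| + 1)) => /= [|y /=]; first exact: divr_gt0.
rewrite ltr_pdivlMr// mulrC; apply: le_lt_trans; apply: le_trans (fC _ _) _.
by apply: ler_wpM2r => //; apply: le_trans (ler_norm _) _; rewrite lerDl.
Qed.

(** By [bjoin_dist] the change of [x \vee - x] is bounded by two copies of [vabs (x - y)], hence the
    constant 2. *)
Lemma vabs_continuous (R : realType) (E : banachLatticeType R) :
  continuous (@vabs R E).
Proof.
apply: (@lipschitz_continuous _ _ _ _ 2) => x y.
have -> : 2 * `|x - y| = `|2 *: vabs (x - y)|.
  rewrite normrZ ger0_norm//; congr (_ * _).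
  by apply/eqP; rewrite eq_le; apply/andP; split; apply: ble_norm;
    rewrite -/(vabs _) -/(vabs _) vabs_idem; exact: ble_refl.
apply: vabs_le_norm; rewrite scaler_nat mulr2n.
by have := bjoin_dist x (- x) y (- y); rewrite -opprD vabsN.
Qed.

(** Pulled back by [g], the vector [f x \vee f y] is an upper bound of [x] and [y], hence lies above
    [x \vee y]; applying [f] gives the nontrivial inequality. *)
Lemma order_bijection_join (R : realType) (E F : banachLatticeType R)
    (f : E -> F) (g : F -> E) :
  (forall x y, x <=L y -> f x <=L f y) -> (forall x y, x <=L y -> g x <=L g y) ->
  cancel f g -> cancel g f -> forall x y, f (x \vee y) = f x \vee f y.
Proof.
move=> f_le g_le fK gK x y; apply: ble_anti; last first.
  by apply/bjoinP; split; apply: f_le; [exact: bjoinL|exact: bjoinR].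
rewrite -[X in _ <=L X]gK; apply: f_le; apply/bjoinP.
by split; [rewrite -{1}(fK x)|rewrite -{1}(fK y)]; apply: g_le;
  [exact: bjoinL|exact: bjoinR].
Qed.

(** * Coordinate functionals on [ell1] *)

Section EllOneCoordinates.
Context {R : realType}.
Implicit Types x y : ell1 R.

Lemma ell1_coord_norm x i : `|x i| <= `|x|.
Proof.
have := @summable_le_norm R x i.+1 (valP x).
by apply: le_trans; rewrite big_nat_recr//= lerDr; apply: sumr_ge0.
Qed.

Lemma ell1_coordD x y i : (x + y : ell1 R) i = x i + y i.
Proof. by []. Qed.

Lemma ell1_coordZ (a : R) x i : (a *: x : ell1 R) i = a * x i.
Proof. by []. Qed.

Lemma ell1_bleE x y : x <=L y <-> forall i, x i <= y i.
Proof. by []. Qed.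

Lemma ell1_coord_continuous i : continuous (fun x : ell1 R => x i).
Proof.
apply: (@lipschitz_continuous _ _ R^o _ 1) => x y.
by rewrite mul1r; exact: (ell1_coord_norm (x - y)).
Qed.

End EllOneCoordinates.

(** * Positive operators vanishing on the orthosymmetric ideal *)

Section OrthosymmetricIdeal.
Context (R : realType) (E G : banachLatticeType R) (T : fremlinTensor E E).
Context (D : {linear T -> G}) (C : R).
Context (D0 : forall t, 0 <=L t -> 0 <=L D t) (DC : forall t, `|D t| <= C * `|t|).
Context (Dperp : forall x y, disjoint_vec x y -> D (tens T (vabs x) (vabs y)) = 0).

Let Dle s t : s <=L t -> D s <=L D t.
Proof. by rewrite (ble_subr s) (ble_subr (D s)) -linearB; exact: D0. Qed.

(** The absolute kernel of [D]: the kernel of a positive operator need not be solid, whereas this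
    set is. *)
Let N : set T := [set t | D (vabs t) = 0].

Let N_le s t : vabs s <=L t -> D t = 0 -> N s.
Proof.
move=> st t0; rewrite /N /=; apply: ble_anti; last by apply: D0; exact: vabs_ge0.
by rewrite -t0; exact: Dle.
Qed.

Let N0 : N 0.
Proof. by rewrite /N /= ger0_vabs ?linear0//; exact: ble_refl. Qed.

Let ND s t : N s -> N t -> N (s + t).
Proof.
by move=> s0 t0; apply: (N_le (ler_vabsD s t)); rewrite linearD s0 t0 addr0.
Qed.

Let NZ (a : R) t : N t -> N (a *: t).
Proof.
move=> t0; apply: (@N_le _ (`|a| *: vabs t)); last by rewrite linearZ/= t0 scaler0.
have le (b : R) x : b *: x <=L `|b| *: vabs x.
  have [b0|b0] := ger0P b; first by apply: bleZ2l => //; exact: vabs_ler.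
  rewrite -(opprK b) scaleNr -scalerN opprK.
  by apply: bleZ2l; [rewrite oppr_ge0 ltW|exact: vabs_lerN].
apply/vabsP; split; first exact: le.
by rewrite -scaleNr -normrN; exact: le.
Qed.

Let N_solid s t : vabs s <=L vabs t -> N t -> N s.
Proof. exact: N_le. Qed.

Let N_closed : closed N.
Proof.
apply: (@preimage_closed T G (D \o @vabs R T) [set 0]); last first.
  exact/accessible_closed_set1/hausdorff_accessible/norm_hausdorff.
move=> t _; apply: continuous_comp; first exact: vabs_continuous.
apply: (@lipschitz_continuous _ _ _ _ C) => x y.
by rewrite -linearB.
Qed.

(** By [bilinear_vabs] and [Dperp] the generators lie in [N], so minimality puts the whole ideal
    there; then [D t] is squeezed between the images of [- vabs t] and [vabs t]. *)
Lemma orthosymmetric_ideal_ker t : orthosymmetric_ideal T t -> D t = 0.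
Proof.
move=> /(_ (ClosedIdeal N0 ND NZ N_solid N_closed)) Jt.
have {Jt} t0 : D (vabs t) = 0.
  apply: Jt => _ [x [y [xy ->]]]; apply: (N_le _ (Dperp xy)).
  exact/bilinear_vabs/tens_positive.
apply: ble_anti; first by rewrite -t0; apply: Dle; exact: vabs_ler.
apply/bleN; rewrite oppr0 -linearN -t0; apply: Dle; exact: vabs_lerN.
Qed.

End OrthosymmetricIdeal.

(** * The diagonal series as a positive contraction from [ell1] *)

Section DiagonalSeries.
Context {R : realType} {E : banachLatticeType R} (T : fremlinTensor E E) (e : nat -> E).
Context (e1 : normalized e).
Implicit Types x y : ell1 R.

Definition diag_term x i : T := x i *: tens T (e i) (e i).

Definition diag x : T := limn (series (diag_term x)).

(** Each e_i (x) e_i has norm at most 1, so the diagonal series converges absolutely by comparison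
    with [x]. *)
Lemma norm_diag_term x i : `|diag_term x i| <= `|x i|.
Proof.
rewrite normrZ ler_piMr//; apply: le_trans (norm_tens _ _ _) _.
by rewrite !e1 mulr1.
Qed.

Lemma normed_diag_cvg x : cvgn [normed series (diag_term x)].
Proof.
apply: (series_le_cvg _ _ (norm_diag_term x)) => //.
exact/summable_seqP/(valP x).
Qed.

Lemma diag_is_cvg x : cvgn (series (diag_term x)).
Proof. exact/normed_cvg/normed_diag_cvg. Qed.

Lemma norm_diag x : `|diag x| <= `|x|.
Proof.
apply: le_trans (lim_series_norm (@normed_diag_cvg x)) _.
apply: lim_series_le (norm_diag_term x); first exact: normed_diag_cvg.
exact/summable_seqP/(valP x).
Qed.

Lemma diag_linear : linear diag.
Proof.
move=> a x y; apply/cvg_lim => //.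
rewrite (_ : series _ = fun n => a *: series (diag_term x) n + series (diag_term y) n).
  by apply: cvgD; [apply: cvgZr|]; exact: diag_is_cvg.
apply/funext => n; rewrite /series /= scaler_sumr -big_split /=.
by apply: eq_bigr => k _; rewrite /diag_term scalerDl scalerA.
Qed.

Lemma diagB x y : diag (x - y) = diag x - diag y.
Proof. by rewrite addrC -scaleN1r diag_linear scaleN1r addrC. Qed.

Lemma diag0 : diag 0 = 0.
Proof. by rewrite -(subrr (0 : ell1 R)) diagB subrr. Qed.

Lemma diag_ge0 x : (forall i, 0 <=L e i) -> 0 <=L x -> 0 <=L diag x.
Proof.
move=> e0 x0; apply: (closed_cvg _ (@closed_ge0 R T) _ _ (@diag_is_cvg x)).
apply: nearW => n; rewrite /series /=; elim: n => [|n IH].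
  by rewrite big_geq//; exact: ble_refl.
rewrite big_nat_recr//=; apply: ble0D => //; apply: ble0Z; first exact: x0.
exact: tens_positive.
Qed.

End DiagonalSeries.

(** * The diagonal operator and its inverse modulo the ideal *)

Section Diagonal.
Context (R : realType) (E : banachLatticeType R) (T : fremlinTensor E E).
Context (e : nat -> E) (M : R).
Context (eB : schauder_basis e) (e0 : basis_defines_order e) (e1 : normalized e).
Context (M0 : 0 < M) (E2 : lower_2_estimate E M).

Local Notation J := (orthosymmetric_ideal T).
Local Notation coord := (basis_coord eB).
Local Notation diag := (diag T e).

Lemma diagonal_functional : exists D : {linear T -> ell1 R}, [/\
  forall x y i, D (tens T x y) i = coord x i * coord y i,
  forall t, `|D t| <= M ^+ 2 * `|t|
  & forall t, 0 <=L t -> 0 <=L D t].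
Proof.
pose psi := diagonal_product eB e0 M0 e1 E2.
pose phi : {bilinear E -> E -> ell1 R} := HB.pack psi
  (bilinear_isBilinear.Build R E E (ell1 R) _ _ psi
    (diagonal_product_bilinear eB e0 M0 e1 E2)).
have phi0 : positive_bilinear phi.
  move=> x y /(ble_basis_coord eB e0) x0 /(ble_basis_coord eB e0) y0.
  by apply/ell1_bleE => i; move: (x0 i) (y0 i); rewrite !basis_coord0; exact: mulr_ge0.
have C0 : 0 < M ^+ 2 by rewrite exprn_gt0.
have [x y x1 y1|D [DE DC D0]] := tensor_extension C0 (tensor_sum_le T C0 phi0 _).
  apply: le_trans (diagonal_product_norm eB e0 M0 e1 E2 x y) _.
  (* On the unit balls the mean of the squared norms is at most 1, which leaves [M ^+ 2]. *)
  rewrite ler_piMr ?(ltW C0)// ler_pdivrMr// mul1r -[leRHS]/(1 + 1).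
  by apply: lerD; rewrite expr_le1.
exists D; split => //; last exact: D0.
by move=> x y i; rewrite DE.
Qed.

Context (D : {linear T -> ell1 R}).
Context (DE : forall x y i, D (tens T x y) i = coord x i * coord y i).
Context (DC : forall t, `|D t| <= M ^+ 2 * `|t|) (D0 : forall t, 0 <=L t -> 0 <=L D t).

Let D_continuous : continuous D.
Proof. by apply: (@lipschitz_continuous _ _ _ _ (M ^+ 2)) => x y; rewrite -linearB. Qed.

Lemma diagonal_functional_ker t : J t -> D t = 0.
Proof.
apply: (orthosymmetric_ideal_ker D0 DC) => x y xy; apply: val_inj; apply/funext => i.
by rewrite [LHS]DE; exact: disjoint_vec_coord.
Qed.

(** Coordinate [i] of [D] is continuous, and on the partial sums of [diag x] it equals [x i] as soon
    as the index [i] is included. *)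
Lemma diagonal_functionalK : cancel diag D.
Proof.
move=> x; apply: val_inj; apply/funext => i /=.
have Dx : (fun n => D (series (diag_term T e x) n) i) @ \oo --> D (diag x) i.
  apply: (cvg_comp (fun n => D (series (diag_term T e x) n)) (fun z : ell1 R => z i)
    _ (@ell1_coord_continuous R i (D (diag x)))).
  by apply: (cvg_comp (series (diag_term T e x)) D _ (@D_continuous (diag x)));
    exact: diag_is_cvg.
rewrite -(cvg_lim _ Dx)//; apply: lim_near_cst => //; exists i.+1 => // n /= ni.
have DS k : D (\sum_(0 <= j < k) diag_term T e x j) i = if (i < k)%N then x i else 0.
  elim: k => [|k IH]; first by rewrite big_geq// linear0.
  rewrite big_nat_recr//= linearD ell1_coordD IH /diag_term linearZ ell1_coordZ DE.
  rewrite !basis_coord_basis ltnS.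
  have [->|ik] := eqVneq i k; first by rewrite ltnn leqnn !mulr1 add0r.
  by rewrite !mulr0 addr0 [(i <= k)%N]leq_eqVlt (negPf ik).
by rewrite [LHS]DS ni.
Qed.

(** The set [S] of good tensors is a closed subspace; it is shown to contain the e_i (x) e_j, then
    all elementary tensors, then their sums and limits. *)
Lemma diag_functional_mod t : J (t - diag (D t)).
Proof.
pose S := [set t | J (t - diag (D t))].
have Scl : closed S.
  (* The identity contributes 1 to the Lipschitz constant, and [diag] after [D] contributes
     [M ^+ 2]. *)
  apply: (@preimage_closed T T (fun t => t - diag (D t))); last exact: ideal_closed.
  move=> s _; apply: (@lipschitz_continuous _ _ _ _ (1 + M ^+ 2)) => x y.
  rewrite opprD addrACA -opprD -(diagB T e1) -!linearB mulrDl mul1r.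
  apply: le_trans (ler_normB _ _) _; apply: lerD => //.
  by apply: le_trans (norm_diag T e1 _) _; exact: DC.
have S0 : S 0 by rewrite /S /= linear0 (diag0 T e1) subrr; exact: (ideal0 J).
have Slin a x y : S x -> S y -> S (a *: x + y).
  move=> Sx Sy; rewrite /S /= linearP (diag_linear T e1) opprD addrACA -scalerBr.
  by apply: (@idealD _ _ J) => //; exact: (@idealZ _ _ J).
have See i j : S (tens T (e i) (e j)).
  rewrite /S /=; have Dij k : D (tens T (e i) (e j)) k = ((k == i) && (k == j))%:R.
    by rewrite DE !basis_coord_basis mulrnAr mulr1 -mulnb mulrnA.
  have [ij|ij] := eqVneq i j.
    (* Here [D] yields the [i]-th unit vector, so the partial sums are constant from index [i.+1]
       on. *)
    subst j; rewrite [diag _](_ : _ = tens T (e i) (e i)) ?subrr; first exact: (ideal0 J).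
    apply: lim_near_cst => //; exists i.+1 => // n /= ni.
    rewrite /series /= (bigD1_seq i) ?mem_index_iota ?iota_uniq//=.
    rewrite /diag_term Dij eqxx scale1r big1 ?addr0// => k ki.
    by rewrite Dij (negPf ki) scale0r.
  have -> : D (tens T (e i) (e j)) = 0.
    apply: val_inj; apply/funext => k; rewrite [LHS]Dij.
    by have [->|//] := eqVneq k i; rewrite (negPf ij).
  (* What remains is e_i (x) e_j itself, a generator of the ideal. *)
  rewrite (diag0 T e1) subr0 => A; apply; exists (e i), (e j); split => //.
  by rewrite -[e i]scale1r -[e j]scale1r; exact: disjoint_vec_basis.
have Se i y : S (tens T (e i) y).
  apply: (basis_span_closed eB (A := [set y | S (tens T (e i) y)])) => //=.
  - apply: (@preimage_closed E T (tens T (e i))) => // x _.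
    apply: (@lipschitz_continuous _ _ _ _ `|e i|) => z w.
    by rewrite -linearBr; exact: norm_tens.
  - by rewrite linear0r.
  - by move=> a z w; rewrite linearDr linearZr_LR; exact: Slin.
have Sxy x y : S (tens T x y).
  apply: (basis_span_closed eB (A := [set x | S (tens T x y)])) => //=.
  - apply: (@preimage_closed E T (tens T ^~ y)) => // z _.
    apply: (@lipschitz_continuous _ _ _ _ `|y|) => w v.
    by rewrite -linearBl mulrC; exact: norm_tens.
  - by rewrite linear0l.
  - by move=> a z w; rewrite linearDl linearZl_LR; exact: Slin.
suff : closure (range (tensor_sum (tens T))) `<=` S by apply; rewrite tens_dense.
rewrite closureE; apply: smallest_sub => // _ [u _ <-].
rewrite /tensor_sum; elim: u => [|p u IH]; first by rewrite big_nil.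
by rewrite big_cons -[tens T _ _]scale1r; exact: Slin.
Qed.

End Diagonal.

Theorem corollary25 (R : realType) (E : banachLatticeType R)
    (T : fremlinTensor E E) (e : nat -> E) (M : R) :
  schauder_basis e -> basis_defines_order e -> normalized e ->
  0 < M -> lower_2_estimate E M ->
  let Phi : ell1 R -> ideal_quotient (orthosymmetric_ideal T) := fun x =>
    quotient_proj (orthosymmetric_ideal T)
      (limn (series (fun i => x i *: tens T (e i) (e i)))) in
  [/\ forall x : ell1 R, cvgn (series (fun i => x i *: tens T (e i) (e i))),
      lattice_isomorphism Phi
    & M = 1 -> lattice_isometry Phi].
Proof.
move=> eB e0 e1 M0 E2 Phi.
have [D [DE DC D0]] := diagonal_functional T eB e0 e1 M0 E2.
set J := orthosymmetric_ideal T in Phi *.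
have kerD := diagonal_functional_ker e0 DE DC D0.
have DK := diagonal_functionalK e1 DE DC.
have /choice[rep repK] : forall q : ideal_quotient J, exists t, quotient_proj J t = q.
  by move=> q; have [t ->] := quotient_proj_surj q; exists t.
pose Psi q := D (rep q).
(* [D] vanishes on the ideal, so [Psi] does not depend on the representative chosen by [rep]. *)
have PsiE t : Psi (quotient_proj J t) = D t.
  apply/eqP; rewrite -subr_eq0 -linearB; apply/eqP/kerD/quotient_projE.
  exact: repK.
have PhiK : cancel Phi Psi by move=> x; rewrite PsiE; exact: DK.
have PsiK : cancel Psi Phi.
  move=> q; rewrite -{1}(repK q) PsiE -{2}(repK q); apply/quotient_projE.
  rewrite -opprB -scaleN1r; apply: idealZ.
  exact: diag_functional_mod.
have Philin : linear Phi.
  move=> a x y; rewrite /Phi -quotient_projZ -quotient_projD; congr quotient_proj.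
  exact: (diag_linear T e1).
(* The positive part of [diag x - diag y] is already 0 before passing to the quotient. *)
have Phi_le x y : x <=L y -> Phi x <=L Phi y.
  move=> xy; apply/quotient_proj_le.
  rewrite (_ : vpos _ = 0); first exact: ideal0.
  apply: ble_anti; last exact: vpos_ge0.
  apply/vposP; split; last exact: ble_refl.
  apply/bleN; rewrite oppr0 opprB -(diagB T e1).
  apply: diag_ge0 => // [i|]; first exact: basis_ge0.
  by rewrite -ble_subr.
(* The order of the quotient puts the positive part of [rep p - rep q] in the ideal, where [D]
   vanishes; only the image of the negative part survives. *)
have Psi_le p q : p <=L q -> Psi p <=L Psi q.
  rewrite -{1}(repK p) -{1}(repK q) => /quotient_proj_le/kerD Dv.
  rewrite /Psi ble_subr -linearB -opprB -(vposB (rep p - rep q)) opprB.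
  by rewrite linearB Dv subr0; apply: D0; exact: vpos_ge0.
have Phi_norm x : `|Phi x| <= `|x|.
  by apply: le_trans (quotient_proj_norm _ _) _; exact: norm_diag.
(* The quotient norm is an infimum over all representatives [t], and each satisfies the bound on
   [D t], which equals [Psi q]. *)
have Psi_norm q : `|Psi q| <= M ^+ 2 * `|q|.
  rewrite -ler_pdivrMl ?exprn_gt0//; apply: lb_le_inf; first by exists `|rep q|, (rep q).
  by move=> _ [t <- ->]; rewrite PsiE ler_pdivrMl ?exprn_gt0.
have iso : lattice_isomorphism Phi.
  split; [split => //|by exists Psi|].
    exact: order_bijection_join Phi_le Psi_le PhiK PsiK.
  (* The lower constant is [Psi_norm] read at [Phi x], because [Psi (Phi x) = x]; for [M = 1] it
     matches the upper one. *)
  exists (M ^- 2), 1; split; first by rewrite invr_gt0 exprn_gt0.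
  move=> x; rewrite mul1r Phi_norm andbT ler_pdivrMl ?exprn_gt0//.
  by rewrite -{1}(PhiK x).
split => // [x|M1]; first exact: (@diag_is_cvg _ _ T e e1 x).
split=> // x; apply/eqP; rewrite eq_le Phi_norm -{1}(PhiK x).
by have := Psi_norm (Phi x); rewrite M1 expr1n mul1r.
Qed.
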